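(* Assume that there exists a countable Borel equivalence relation $E$ on $[\mathbb{N}]^\mathbb{N}$ which is not hyperfinite but such that the restriction of ${=}_{[\mathbb{N}]^\mathbb{N}}\times E$ to the set $\mathcal{D}=\{(x,y)\in[\mathbb{N}]^\mathbb{N}\times[\mathbb{N}]^\mathbb{N}: y\leq^\infty x\}$ is hyperfinite. Then the hyperfinite countable Borel equivalence relations form a $\mathbf{\Sigma}^1_2$-complete set (for every Polish $X$ the set of Borel codes of hyperfinite CBERs on $X$ is $\mathbf{\Sigma}^1_2$, and for some Polish $X$ it is $\mathbf{\Sigma}^1_2$-hard).
   Context: $[\mathbb{N}]^\mathbb{N}$ is the set of infinite subsets of $\mathbb{N}$, identified with their increasing enumerations. For $x,y\in[\mathbb{N}]^\mathbb{N}$, $y\leq^\infty x$ means $\{n: y(n)\leq x(n)\}$ is infinite. ${=}_{[\mathbb{N}]^\mathbb{N}}\times E$ is the equivalence relation on $([\mathbb{N}]^\mathbb{N})^2$ with $(x,y)\sim(x',y')$ iff $x=x'$ and $yEy'$; restriction to $\mathcal{D}$ means intersecting with $\mathcal{D}^2$. A CBER is a Borel equivalence relation with countable classes; it is hyperfinite if it is an increasing union of Borel equivalence relations with finite classes. Borel sets are coded via a fixed standard coding $\mathbf{BC}(W)\subseteq\mathbb{N}^\mathbb{N}$ (a $\mathbf{\Pi}^1_1$ set of codes for Borel subsets of a Polish space $W$). A set $A$ in a Polish space is $\mathbf{\Sigma}^1_2$-hard if every $\mathbf{\Sigma}^1_2$ subset $B$ of any Polish $V$ is of the form $f^{-1}(A)$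 for a continuous $f$; complete if moreover $A\in\mathbf{\Sigma}^1_2$.
   Formalization: In the definition of Σ¹₂-hardness, V ranges only over Polish spaces whose points are separated by clopen sets; for other V (e.g. the reals, with B a single point) no continuous map into the space of codes in N^N can give B as a preimage, so the literal definition is unsatisfiable. *)

(* Defs.v *)
From HB Require Import structures.
From mathcomp Require Import all_boot all_order all_algebra.
From mathcomp Require Import all_classical reals topology.
From mathcomp Require Import measurable_structure.

Set Implicit Arguments.
Unset Strict Implicit.
Unset Printing Implicit Defensive.

Import Order.TTheory GRing.Theory Num.Theory.

Local Open Scope classical_set_scope.
Local Open Scope ring_scope.

Definition polish (R : realType) (T : topologicalType) : Prop :=
  @second_countable T /\
  exists d : T -> T -> R,
    [/\ (forall x y, d x y = 0 <-> x = y),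
        (forall x y, d x y = d y x),
        (forall x y z, d x z <= d x y + d y z),
        (forall x (A : set T),
           nbhs x A <-> exists2 e : R, 0 < e & [set y | d x y < e] `<=` A) &
        (forall u : nat -> T,
           (forall e : R, 0 < e -> exists N, forall m n,
              (N <= m)%N -> (N <= n)%N -> d (u m) (u n) < e) ->
           exists l : T, u @ \oo --> l)].

Definition borel (T : topologicalType) (A : set T) : Prop := <<s @open T >> A.

Definition baire : Type := prod_topology (fun _ : nat => nat).
HB.instance Definition _ := Pointed.on baire.
HB.instance Definition _ := Nbhs.on baire.
HB.instance Definition _ := Topological.on baire.

(* The space of infinite sets of naturals, each of them given by its
   increasing enumeration; the topology is the one induced by the Baire
   space. *)
Definition infsets : Type :=
  set_type [set x : baire | forall m n, (m < n)%N -> (x m < x n)%N].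
HB.instance Definition _ := Choice.on infsets.
HB.instance Definition _ := Nbhs.on infsets.
HB.instance Definition _ := Topological.on infsets.

Definition enumeration (x : infsets) : nat -> nat := set_val x.

Definition le_infty (y x : infsets) : Prop :=
  infinite_set [set n | (enumeration y n <= enumeration x n)%N].

Section projective.
Context (T : topologicalType).

Definition Sigma11 (A : set T) : Prop :=
  exists2 C : set (T * baire), closed C & A = [set x | exists z, C (x, z)].

Definition Pi11 (A : set T) : Prop := Sigma11 (~` A).

End projective.

Definition Sigma12 (T : topologicalType) (A : set T) : Prop :=
  exists2 C : set (T * baire), Pi11 C & A = [set x | exists z, C (x, z)].

(* As T will be a space of codes included in the Baire space, continuous maps
   from V to T do not distinguish points that are not separated by clopen sets;
   hence the usual requirement that V be zero-dimensional, here in the weak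
   form that clopen sets separate points. *)
Definition Sigma12_hard (R : realType) (T : topologicalType) (A : set T)
    : Prop :=
  forall V : topologicalType, polish R V -> zero_dimensional V ->
  forall B : set V, Sigma12 B ->
  exists2 f : V -> T, continuous f & B = f @^-1` A.

Section equivalence_relations.
Context (T : topologicalType).
Implicit Types (D : set T) (E F : set (T * T)).

Definition equivalence_on D E : Prop :=
  [/\ E `<=` D `*` D,
      (forall x, D x -> E (x, x)),
      (forall x y, E (x, y) -> E (y, x)) &
      (forall x y z, E (x, y) -> E (y, z) -> E (x, z))].

Definition borel_equivalence_on D E : Prop := equivalence_on D E /\ borel E.

Definition cber_on D E : Prop :=
  borel_equivalence_on D E /\ forall x, countable [set y | E (x, y)].

Definition hyperfinite_on D E : Prop :=
  cber_on D E /\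
  exists F : nat -> set (T * T),
    [/\ (forall n, borel_equivalence_on D (F n)),
        (forall n x, finite_set [set y | F n (x, y)]),
        (forall n, F n `<=` F n.+1) &
        E = \bigcup_n F n].

End equivalence_relations.

Definition eq_times (S T : Type) (E : set (T * T))
    : set ((S * T) * (S * T)) :=
  [set p | p.1.1 = p.2.1 /\ E (p.1.2, p.2.2)].

Definition er_restrict (T : Type) (E : set (T * T)) (D : set T) : set (T * T) :=
  E `&` (D `*` D).

Definition code_tail (c : baire) : baire := fun k => c k.+1.

(* The n-th of the sequence of codes packed in c, through the bijection
   (n, k) |-> 2 ^ n * (2 * k + 1) - 1 from pairs of naturals to naturals. *)
Definition code_nth (c : baire) (n : nat) : baire :=
  fun k => c ((2 ^ n * k.*2.+1).-1)%N.

(* borel_code U c A: c is a Borel code, and it codes A, with respect to the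
   enumeration U of an open basis. *)
Inductive borel_code (W : topologicalType) (U : nat -> set W)
    : baire -> set W -> Prop :=
| borel_code_basic c : c 0%N = 0%N -> borel_code U c (U (c 1%N))
| borel_code_compl c A : c 0%N = 1%N ->
    borel_code U (code_tail c) A -> borel_code U c (~` A)
| borel_code_union c (A : nat -> set W) : (2 <= c 0)%N ->
    (forall n, borel_code U (code_nth (code_tail c) n) (A n)) ->
    borel_code U c (\bigcup_n A n).

Definition hyperfinite_codes (X : topologicalType) (U : nat -> set (X * X))
    : set baire :=
  [set c | exists2 E, borel_code U c E & hyperfinite_on setT E].

Local Close Scope ring_scope.

Lemma borel_code_inj (W : topologicalType) (U : nat -> set W) c A B :
  borel_code U c A -> borel_code U c B -> A = B.
Proof.
move=> cA; elim: cA B => {c A}.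
- by move=> c c0 B cB; inversion cB; subst => //; move: H; rewrite c0.
- move=> c A c0 _ IH B cB; inversion cB; subst.
  + by move: H; rewrite c0.
  + by rewrite (IH _ H0).
  + by move: H; rewrite c0.
- move=> c A c0 _ IH B cB; inversion cB; subst.
  + by move: c0; rewrite H.
  + by move: c0; rewrite H.
  + by apply: eq_bigcupr => n _; exact: IH.
Qed.

Lemma borel_codeE (W : topologicalType) (U : nat -> set W) A :
  basis (range U) -> (exists c, borel_code U c A) <-> borel A.
Proof.
move=> [oU bU]; split.
- case=> c; elim => {c A}.
  + by move=> c _; apply: sub_sigma_algebra; apply: oU; exists (c 1%N).
  + by move=> c A _ _ bA; rewrite -setTD; exact: sigma_algebraCD.
  + by move=> c A _ _ bA; exact: sigma_algebra_bigcup.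
- have codeC B : (exists c, borel_code U c B) -> exists c, borel_code U c (~` B).
    case=> c cB; pose c' : baire := fun k => if k is k'.+1 then c k' else 1%N.
    by exists c'; apply: borel_code_compl.
  have codeU (B : nat -> set W) : (forall n, exists c, borel_code U c (B n)) ->
      exists c, borel_code U c (\bigcup_n B n).
    move=> /choice[f fB].
    pose g j := logn 2 j.+1.
    pose c : baire := fun k =>
      if k is k'.+1 then f (g k') ((k'.+1 %/ 2 ^ g k')./2) else 2%N.
    exists c; apply: borel_code_union => // n.
    suff -> : code_nth (code_tail c) n = f n by [].
    apply/funext => k; rewrite /code_nth /code_tail /= /g.
    rewrite prednK ?muln_gt0 ?expn_gt0 //.
    have -> : logn 2 (2 ^ n * k.*2.+1) = n.
      rewrite lognM ?expn_gt0// pfactorK// logn_coprime ?addn0 //.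
      by rewrite coprime2n /= odd_double.
    by rewrite mulKn ?expn_gt0 // /= uphalf_double.
  have code0 : exists c, borel_code U c set0.
    have [c cT] : exists c, borel_code U c [set: W].
      have e0 : exists c, borel_code U c (U 0%N).
        by exists (fun=> 0%N); exact: borel_code_basic.
      pose B n := if n is 0 then U 0%N else ~` U 0%N.
      have [|c cB] := codeU B; first by case=> [|n] /=; [exact: e0|exact: codeC].
      exists c; suff <- : \bigcup_n B n = [set: W] by [].
      rewrite eqEsubset; split=> // x _.
      by have [?|?] := pselect (U 0%N x); [exists 0%N|exists 1%N].
    by rewrite -setCT; apply: codeC; exists c.
  move: A; apply: (@smallest_sub _ _ _ [set A | exists c, borel_code U c A]).
    split=> //.
    by move=> B cB; rewrite setTD; exact: codeC.
  move=> O oO.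
  have -> : O = \bigcup_n (if pselect (U n `<=` O) then U n else set0).
    rewrite eqEsubset; split.
      move=> x Ox; have [|_ [[n _ <-] Unx] UO] := bU x O.
        by move: oO; rewrite openE; apply.
      by exists n => //; case: pselect.
    by move=> x [n _]; case: pselect => // UO /UO.
  apply: codeU => n; case: (pselect _) => /= [_|_]; last exact: code0.
  pose c : baire := fun k => if k is 0 then 0%N else n.
  by exists c; exact: (@borel_code_basic _ U c).
Qed.

(* Main.v *)
Require Import Defs.
From mathcomp Require Import all_boot all_order all_algebra.
From mathcomp Require Import all_classical reals topology.
From mathcomp Require Import measurable_structure lra zify.

Set Implicit Arguments.
Unset Strict Implicit.
Unset Printing Implicit Defensive.

Import Order.TTheory GRing.Theory Num.Theory.

Local Open Scope classical_set_scope.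

(* A witness of hyperfiniteness can be refuted by a "bad family", a sequence of
   pairwise related points on which the coded relations are not an increasing
   sequence of finite equivalence relations exhausting the given one; this is an
   analytic condition on the code, whence the upper bound.

   For the lower bound let v \in B iff there is z such that the tree T_(v,z) has
   no branch. On pairs (e, y), with e coding a sequence of Borel relations and y
   an infinite set, consider the relation (=) x E restricted to the set S_v of
   those (e, y) such that y dominates no element of K_(v,e). An element of
   K_(v,e) is a pair of some z and of a monotone length preserving map from
   T_(v,z) to the tree of attempts to build a bad family for e inside S_v. This
   circular definition of the closed set K is resolved by recursion on finite
   approximations.
   - If v is not in B, then some bad family for e lies in S_v as soon as e has a
     bad family: otherwise a member of it dominates some element of K_(v,e), and
     a branch of T_(v,z) is mapped to a bad family inside S_v. As E is not
     hyperfinite, every code e of a would-be witness has a bad family.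
   - If v is in B through z, then for each e either some map as above exists; it
     can be chosen in a Borel way by recursion on the well-founded T_(v,z), and
     bounds the y with (e, y) in S_v in the sense of <=^infty, so that the
     hypothesis on D applies; or there is no bad family for e in S_v, and the
     relations coded by e are themselves a witness, Borel in e by Lusin
     separation. *)

(** * The topology of the Baire space *)

Definition agree (n : nat) (x y : baire) := forall i, (i < n)%N -> x i = y i.

Lemma agree_refl n x : agree n x x. Proof. by []. Qed.

Lemma agree_sym n x y : agree n x y -> agree n y x.
Proof. by move=> h i /h. Qed.

Lemma agree_trans n y x z : agree n x y -> agree n y z -> agree n x z.
Proof. by move=> h h' i ni; rewrite h // h'. Qed.

Lemma agree_leq m n x y : (m <= n)%N -> agree n x y -> agree m x y.
Proof. by move=> mn h i im; apply: h; exact: leq_trans mn. Qed.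

Lemma nbhs_agree n (x : baire) : nbhs x [set y | agree n x y].
Proof.
elim: n => [|n IH]; first by apply: filterS filterT.
have px : nbhs x [set y : baire | x n = y n].
  have := @proj_continuous nat (fun _ => nat) n x.
  move=> /(_ [set k | x n = k]); apply.
  exact: (@filterS _ (nbhs (x n)) _ [set x n]) (discrete_set1 _).
apply: filterS (filterI IH px) => y [h1 h2] i.
by rewrite ltnS leq_eqVlt => /predU1P[->//|/h1].
Qed.

Lemma nbhs_baireP (x : baire) (A : set baire) :
  nbhs x A <-> exists n, [set y | agree n x y] `<=` A.
Proof.
split; last by case=> n; move=> /filterS; apply; exact: nbhs_agree.
pose F : set_system baire := [set B | exists n, [set y | agree n x y] `<=` B].
have FF : Filter F.
  split; first by exists 0%N.
  - move=> P Q [m mP] [n nQ]; exists (maxn m n) => y h; split.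
      by apply: mP; apply: agree_leq h; rewrite leq_maxl.
    by apply: nQ; apply: agree_leq h; rewrite leq_maxr.
  - by move=> P Q PQ [n nP]; exists n; apply: subset_trans PQ.
(* Unfolded, [F --> x] is the claim. The product topology is a supremum of initial topologies, so it
   is checked one coordinate at a time, and coordinate [i] is fixed by agreement up to [i.+1]. *)
have : F --> x.
  apply/cvg_sup => i B /= -[_ /= [[C oC <-] /= Cx CB]].
  exists i.+1 => y h; apply: CB; rewrite /= -(h i (leqnn _)); exact: Cx.
by apply.
Qed.

(** * Locally constant maps *)

Section locally_constant.
Context (T : topologicalType).

(** Continuity into the discrete space [S], which needs no topology on [S]. With [S := Prop] it
    expresses that a set is clopen. *)
Definition lconst (S : Type) (f : T -> S) :=
  forall t, nbhs t [set u | f u = f t].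

Lemma lconst_cst S (a : S) : lconst (fun _ => a).
Proof. by move=> t; apply: filterS filterT. Qed.

Lemma lconst_comp S S' (h : S -> S') (f : T -> S) :
  lconst f -> lconst (fun t => h (f t)).
Proof. by move=> cf t; apply: filterS (cf t) => u /= ->. Qed.

Lemma lconst_app S S' (g : S -> T -> S') (f : T -> S) :
  lconst f -> (forall k, lconst (g k)) -> lconst (fun t => g (f t) t).
Proof.
move=> cf cg t; apply: filterS (filterI (cf t) (cg (f t) t)) => u /= [-> ->].
by [].
Qed.

Lemma lconst_comp2 S S' S'' (h : S -> S' -> S'') (f : T -> S) (g : T -> S') :
  lconst f -> lconst g -> lconst (fun t => h (f t) (g t)).
Proof.
move=> cf cg; apply: (lconst_app (g := fun k t => h k (g t)) cf) => k.
exact: lconst_comp.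
Qed.

Lemma lconst_open (P : T -> Prop) : lconst P -> open [set t | P t].
Proof. by move=> cP; rewrite openE => t Pt; apply: filterS (cP t) => u /= ->. Qed.

Lemma lconst_closed (P : T -> Prop) : lconst P -> closed [set t | P t].
Proof.
move=> cP; rewrite -openC; have -> : ~` [set t | P t] = [set t | ~ P t] by [].
by apply: lconst_open; exact: (lconst_comp not).
Qed.

Lemma lconst_agree (f : T -> baire) : (forall i, lconst (fun t => f t i)) ->
  forall n t, nbhs t [set u | agree n (f t) (f u)].
Proof.
move=> cf; elim=> [|n IH] t; first by apply: filterS filterT.
apply: filterS (filterI (IH t) (cf n t)) => u /= [h h'] i.
by rewrite ltnS leq_eqVlt => /predU1P[->|/h].
Qed.

Lemma continuous_baireP (f : T -> baire) :
  continuous f <-> forall i, lconst (fun t => f t i).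
Proof.
split=> cf.
  move=> i t; have h : nbhs t [set u | agree i.+1 (f t) (f u)].
    exact: (cf t _ (nbhs_agree i.+1 (f t))).
  by apply: filterS h => u /(_ i (leqnn _)) /= ->.
move=> t A /nbhs_baireP[n nA]; change (nbhs t (f @^-1` A)).
by apply: filterS (lconst_agree cf n t) => u /nA.
Qed.

End locally_constant.

Lemma lconst_coord i : lconst (fun x : baire => x i).
Proof. by move: i; apply/continuous_baireP => x; exact: cvg_id. Qed.

Lemma lconst_precomp (T U : topologicalType) S (f : U -> S) (h : T -> U) :
  continuous h -> lconst f -> lconst (fun t => f (h t)).
Proof. by move=> ch cf t; exact: (ch t _ (cf (h t))). Qed.

Lemma lconst_at (T : topologicalType) (f : T -> baire) (k : T -> nat) :
  continuous f -> lconst k -> lconst (fun t => f t (k t)).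
Proof.
move=> /continuous_baireP cf ck.
exact: (lconst_app (g := fun i t => f t i)).
Qed.

Lemma lconst_determined (T : topologicalType) S (f : T -> baire)
    (h : baire -> S) n :
  continuous f -> (forall x y, agree n x y -> h x = h y) ->
  lconst (fun t => h (f t)).
Proof.
move=> /continuous_baireP cf hn t.
by apply: filterS (lconst_agree cf n t) => u /= /hn.
Qed.

(** * Coding sequences of points of the Baire space *)

(** Right inverse of [code_nth]: position [k] is decoded by writing [k.+1] as a power of two times
    an odd number. *)
Definition pack (f : nat -> baire) : baire :=
  fun k => f (logn 2 k.+1) ((k.+1 %/ 2 ^ logn 2 k.+1)./2).

Lemma pack_at (f : nat -> baire) n k : pack f ((2 ^ n * k.*2.+1).-1)%N = f n k.
Proof.
rewrite /pack prednK ?muln_gt0 ?expn_gt0 //.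
have -> : logn 2 (2 ^ n * k.*2.+1) = n.
  rewrite lognM ?expn_gt0// pfactorK// logn_coprime ?addn0 //.
  by rewrite coprime2n /= odd_double.
by rewrite mulKn ?expn_gt0 // /= uphalf_double.
Qed.

Lemma packK f n : code_nth (pack f) n = f n.
Proof. by apply/funext => k; rewrite /code_nth pack_at. Qed.

Lemma pack_continuous (T : topologicalType) (f : T -> nat -> baire) :
  (forall n, continuous (fun t => f t n)) -> continuous (fun t => pack (f t)).
Proof.
move=> cf; apply/continuous_baireP => i; rewrite /pack.
by move: (cf (logn 2 i.+1)) => /continuous_baireP.
Qed.

Lemma code_nth_continuous n : continuous (fun c => code_nth c n).
Proof. by apply/continuous_baireP => i; exact: lconst_coord. Qed.

Lemma code_tail_continuous : continuous code_tail.
Proof. by apply/continuous_baireP => i; exact: lconst_coord. Qed.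

Lemma continuous_pair (T U V : topologicalType) (f : T -> U) (g : T -> V) :
  continuous f -> continuous g -> continuous (fun t => (f t, g t)).
Proof. by move=> cf cg t; apply: cvg_pair; [exact: cf|exact: cg]. Qed.

Lemma continuous_comp2 (T U V : topologicalType) (f : T -> U) (g : U -> V) :
  continuous f -> continuous g -> continuous (fun t => g (f t)).
Proof. by move=> cf cg t; apply: continuous_comp; [exact: cf|exact: cg]. Qed.

Lemma id_continuous (T : topologicalType) : continuous (fun t : T => t).
Proof. by move=> t; exact: cvg_id. Qed.

Lemma fst_continuous (T U : topologicalType) : continuous (@fst T U).
Proof. by move=> t; exact: cvg_fst. Qed.

Lemma snd_continuous (T U : topologicalType) : continuous (@snd T U).
Proof. by move=> t; exact: cvg_snd. Qed.

Definition bpair (x y : baire) : baire :=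
  fun n => if odd n then y n./2 else x n./2.
Definition bfst (x : baire) : baire := fun n => x n.*2.
Definition bsnd (x : baire) : baire := fun n => x n.*2.+1.

Lemma bfstK x y : bfst (bpair x y) = x.
Proof. by apply/funext => n; rewrite /bfst /bpair odd_double doubleK. Qed.

Lemma bsndK x y : bsnd (bpair x y) = y.
Proof. by apply/funext => n; rewrite /bsnd /bpair /= odd_double uphalf_double. Qed.

Lemma bpairK x : bpair (bfst x) (bsnd x) = x.
Proof.
apply/funext => n; rewrite /bpair /bfst /bsnd.
by have := odd_double_half n; case: ifP => _ /= E; rewrite -[in RHS]E.
Qed.

Lemma bpair_continuous (T : topologicalType) (f g : T -> baire) :
  continuous f -> continuous g -> continuous (fun t => bpair (f t) (g t)).
Proof.
move=> /continuous_baireP cf /continuous_baireP cg.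
by apply/continuous_baireP => i; rewrite /bpair; case: (odd i).
Qed.

Lemma bfst_continuous : continuous bfst.
Proof. by apply/continuous_baireP => i; exact: lconst_coord. Qed.

Lemma bsnd_continuous : continuous bsnd.
Proof. by apply/continuous_baireP => i; exact: lconst_coord. Qed.

Lemma closed_forall (T : topologicalType) (I : Type) (C : I -> set T) :
  (forall i, closed (C i)) -> closed [set t | forall i, C i t].
Proof.
move=> cC; have -> : [set t | forall i, C i t] = \bigcap_i C i.
  by apply/seteqP; split=> t h i //; exact: h.
by apply: closed_bigI => i _.
Qed.

Lemma closed_agree (C : set baire) x : closed C ->
  (forall n, exists2 y, C y & agree n x y) -> C x.
Proof.
move=> cC h; apply: cC => B /nbhs_baireP[n nB].
by have [y Cy xy] := h n; exists y; split=> //; exact: nB.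
Qed.

(** * Analytic sets *)

Section sigma11.
Context (T : topologicalType).
Implicit Types A : set T.

Lemma closed_Sigma11 A : closed A -> Sigma11 A.
Proof.
move=> cA; exists (fst @^-1` A).
  by move/continuous_closedP: (@fst_continuous T baire) => /(_ _ cA).
by apply/seteqP; split=> [x Ax|x [z]] //; exists (fun _ => 0%N).
Qed.

Lemma Sigma11_preimage (S : topologicalType) (f : S -> T) A :
  continuous f -> Sigma11 A -> Sigma11 (f @^-1` A).
Proof.
move=> cf [C cC ->]; exists ((fun p => (f p.1, p.2)) @^-1` C) => //.
apply: (proj1 (continuous_closedP _)) cC; apply: continuous_pair.
  by apply: continuous_comp2 cf; exact: fst_continuous.
exact: snd_continuous.
Qed.

(** The witnesses chosen for the various [n] are packed into a single point. *)
Lemma Sigma11_forall (A : nat -> set T) :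
  (forall n, Sigma11 (A n)) -> Sigma11 [set t | forall n, A n t].
Proof.
move=> h; have {h}/choice[C hC] : forall n, exists C : set (T * baire),
    closed C /\ A n = [set x | exists z, C (x, z)].
  by move=> n; have [C ? ?] := h n; exists C.
exists [set p | forall n, C n (p.1, code_nth p.2 n)].
  apply: closed_forall => n; have [cC _] := hC n.
  apply: (proj1 (continuous_closedP (fun p : T * baire => (p.1, code_nth p.2 n))))
    cC.
  apply: continuous_pair; first exact: fst_continuous.
  by apply: continuous_comp2 (@code_nth_continuous n); exact: snd_continuous.
apply/seteqP; split=> [x Ax|x [z hz] n].
  have /choice[z hz] : forall n, exists z, C n (x, z).
    by move=> n; have := Ax n; rewrite (proj2 (hC n)).
  by exists (pack z) => n /=; rewrite packK.
by rewrite (proj2 (hC n)); exists (code_nth z n); exact: hz.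
Qed.

(** The index is stored as the first value of the witness; as this value is locally constant, the
    matrix stays closed. *)
Lemma Sigma11_existsn (A : nat -> set T) :
  (forall n, Sigma11 (A n)) -> Sigma11 [set t | exists n, A n t].
Proof.
move=> h; have {h}/choice[C hC] : forall n, exists C : set (T * baire),
    closed C /\ A n = [set x | exists z, C (x, z)].
  by move=> n; have [C ? ?] := h n; exists C.
exists [set p | C (p.2 0%N) (p.1, code_tail p.2)].
  rewrite -openC openE => -[x z] /= nC.
  pose f (p : T * baire) := (p.1, code_tail p.2).
  have cf : continuous f.
    apply: continuous_pair; first exact: fst_continuous.
    by apply: continuous_comp2 code_tail_continuous; exact: snd_continuous.
  have oC : open (~` C (z 0%N)) by rewrite openC; case: (hC (z 0%N)).
  have h1 : nbhs (x, z) (f @^-1` (~` C (z 0%N))).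
    exact: (cf (x, z) _ (open_nbhs_nbhs (conj oC nC))).
  have h2 : nbhs (x, z) [set p : T * baire | p.2 0%N = z 0%N].
    by have /= := lconst_precomp (@snd_continuous T baire) (@lconst_coord 0%N) (x, z).
  by apply: filterS (filterI h1 h2) => -[x' z'] /= [h ->].
apply/seteqP; split=> [x [n]|x [z hz]].
  rewrite (proj2 (hC n)) => -[z hz].
  by exists (fun k => if k is k'.+1 then z k' else n).
by exists (z 0%N); rewrite (proj2 (hC _)); exists (code_tail z).
Qed.

Lemma Sigma11_proj (A : set (T * baire)) :
  Sigma11 A -> Sigma11 [set t | exists z, A (t, z)].
Proof.
move=> [C cC ->].
exists ((fun p => ((p.1, bfst p.2), bsnd p.2)) @^-1` C).
  apply: (proj1 (continuous_closedP
    (fun p : T * baire => ((p.1, bfst p.2), bsnd p.2)))) cC.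
  apply: continuous_pair; first apply: continuous_pair.
  - exact: fst_continuous.
  - by apply: continuous_comp2 bfst_continuous; exact: snd_continuous.
  - by apply: continuous_comp2 bsnd_continuous; exact: snd_continuous.
apply/seteqP; split=> [x [z [w h]]|x [z h]].
  by exists (bpair z w); rewrite /= bfstK bsndK.
by exists (bfst z), (bsnd z).
Qed.

Lemma Sigma11_and A B : Sigma11 A -> Sigma11 B -> Sigma11 [set t | A t /\ B t].
Proof.
move=> hA hB.
have -> : [set t | A t /\ B t] =
    [set t | forall n : nat, (if n == 0%N then A else B) t].
  apply/seteqP; split=> [t [? ?] [|n]|t h] //.
  by split; [exact: (h 0%N)|exact: (h 1%N)].
by apply: Sigma11_forall => -[|n].
Qed.

Lemma Sigma11_or A B : Sigma11 A -> Sigma11 B -> Sigma11 [set t | A t \/ B t].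
Proof.
move=> hA hB.
have -> : [set t | A t \/ B t] =
    [set t | exists n : nat, (if n == 0%N then A else B) t].
  apply/seteqP; split=> [t [?|?]|t [[|n] h]]; by [exists 0%N|exists 1%N|left|right].
by apply: Sigma11_existsn => -[|n].
Qed.

Lemma lconst_Sigma11 (P : T -> Prop) : lconst P -> Sigma11 [set t | P t].
Proof. by move=> cP; apply: closed_Sigma11; exact: lconst_closed. Qed.

End sigma11.

(** Dependent choice along finite sequences, used whenever a branch is built from nodes that can
    always be extended: Lusin separation, infinite injections, compactness, well-foundedness. *)
Lemma dependent_choice_seq (T : Type) (P : seq T -> Prop) :
  P [::] -> (forall s, P s -> exists a, P (rcons s a)) ->
  exists u : nat -> T, forall k, P (mkseq u k).
Proof.
move=> P0 PS; have [a0 _] := PS _ P0.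
have /choice[g gP] : forall s, exists a, P s -> P (rcons s a).
  move=> s; have [/PS[a Pa]|nP] := pselect (P s); first by exists a.
  by exists a0.
pose st k := iter k (fun s => rcons s (g s)) [::].
exists (fun i => g (st i)) => k.
have -> : mkseq (fun i => g (st i)) k = st k.
  by elim: k => // k IH; rewrite mkseqS IH.
by elim: k => //= k; exact: gP.
Qed.

(** * Borel sets *)

Section borel_sets.
Context (T : topologicalType).
Implicit Types A B : set T.

Lemma open_borel A : open A -> borel A.
Proof. exact: sub_sigma_algebra. Qed.

Lemma borel_not A : borel A -> borel [set t | ~ A t].
Proof. by move=> bA; have := sigma_algebraCD bA; rewrite setTD. Qed.

Lemma lconst_borel (P : T -> Prop) : lconst P -> borel [set t | P t].
Proof. by move=> /lconst_open; exact: open_borel. Qed.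

Lemma borel_existsn (A : nat -> set T) :
  (forall n, borel (A n)) -> borel [set t | exists n, A n t].
Proof.
move=> bA; have -> : [set t | exists n, A n t] = \bigcup_n A n.
  by apply/seteqP; split=> [t [n ?]|t [n _ ?]]; exists n.
exact: sigma_algebra_bigcup.
Qed.

Lemma borel_forall (A : nat -> set T) :
  (forall n, borel (A n)) -> borel [set t | forall n, A n t].
Proof.
move=> bA; have -> : [set t | forall n, A n t] =
    [set t | ~ [set t | exists n, ~ A n t] t].
  by apply/seteqP; split=> [t h [n]|t /forallNP h n]; [exact|apply: contrapT].
by apply: borel_not; apply: borel_existsn => n; exact: borel_not.
Qed.

Lemma borel_or A B : borel A -> borel B -> borel [set t | A t \/ B t].
Proof.
move=> hA hB.
have -> : [set t | A t \/ B t] =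
    [set t | exists n : nat, (if n == 0%N then A else B) t].
  apply/seteqP; split=> [t [?|?]|t [[|n] h]]; by [exists 0%N|exists 1%N|left|right].
by apply: borel_existsn => -[|n].
Qed.

Lemma borel_and A B : borel A -> borel B -> borel [set t | A t /\ B t].
Proof.
move=> hA hB.
have -> : [set t | A t /\ B t] =
    [set t | forall n : nat, (if n == 0%N then A else B) t].
  apply/seteqP; split=> [t [? ?] [|n]|t h] //.
  by split; [exact: (h 0%N)|exact: (h 1%N)].
by apply: borel_forall => -[|n].
Qed.

End borel_sets.

Lemma borel_impl (T : topologicalType) (P : Prop) (A : set T) :
  (P -> borel A) -> borel [set t | P -> A t].
Proof.
move=> h; have [/[dup] Pp /h|nP] := pselect P.
  suff -> : [set t | P -> A t] = A by [].
  by apply/seteqP; split=> t /= ?; auto.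
have -> : [set t | P -> A t] = setT.
  by apply/seteqP; split=> // t _ /nP.
exact: lconst_borel (lconst_cst True).
Qed.

Lemma borel_preimage_gen (S T : topologicalType) (f : S -> T) :
  (forall O, open O -> borel (f @^-1` O)) ->
  forall A, borel A -> borel (f @^-1` A).
Proof.
move=> fO A; move: A.
apply: (@smallest_sub _ _ _ [set A | borel (f @^-1` A)]) => //=.
split=> [|A bA|A bA].
- by rewrite /= preimage_set0; exact: sigma_algebra0.
- by rewrite /= setTD preimage_setC; exact: borel_not.
- by rewrite /= preimage_bigcup; exact: sigma_algebra_bigcup.
Qed.

Lemma borel_preimage (S T : topologicalType) (f : S -> T) A :
  continuous f -> borel A -> borel (f @^-1` A).
Proof.
move=> cf; apply: borel_preimage_gen => O oO; apply: open_borel.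
by move/continuousP : cf; apply.
Qed.

(** An open set is a union of countably many cylinders, here listed by a length [k] and a coded list
    [s]; so a map with Borel coordinates is Borel. *)
Lemma borel_preimage_baire (T : topologicalType) (f : T -> baire) (A : set baire) :
  (forall i m, borel [set t | f t i = m]) -> borel A -> borel (f @^-1` A).
Proof.
move=> bf; apply: borel_preimage_gen => O oO.
have -> : f @^-1` O = [set t | exists k, exists s : nat,
    (forall y, agree k (fun i => nth 0%N (odflt [::] (unpickle s)) i) y -> O y) /\
    forall i, (i < k)%N -> f t i = nth 0%N (odflt [::] (unpickle s)) i].
  apply/seteqP; split=> [t Oft|t [k [s [h h']]]]; last first.
    by apply: h => i ik; rewrite h'.
  have : nbhs (f t) O by exact: open_nbhs_nbhs.
  move/nbhs_baireP => [k hk]; exists k, (pickle (mkseq (f t) k)).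
  rewrite pickleK /=; split=> [y h|i ik]; last by rewrite nth_mkseq.
  by apply: hk => i ik; rewrite -h // nth_mkseq.
apply: borel_existsn => k; apply: borel_existsn => s; apply: borel_and.
  exact: lconst_borel (lconst_cst _).
by apply: borel_forall => i; apply: borel_impl => _; exact: bf.
Qed.

Lemma open_baire_exists (O : set baire) : open O ->
  O = [set x | exists n, forall y, agree n x y -> O y].
Proof.
move=> oO; apply/seteqP; split=> [x Ox|x [n]]; last by apply; exact: agree_refl.
have : nbhs x O by exact: open_nbhs_nbhs.
by move/nbhs_baireP => [n h]; exists n.
Qed.

Lemma lconst_cylinder n (O : set baire) :
  lconst (fun x => forall y, agree n x y -> O y).
Proof.
apply: (@lconst_determined baire Prop id
  (fun x => forall y, agree n x y -> O y) n) => [|x y xy].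
  exact: id_continuous.
apply/propext; split=> h z ?; apply: h; first exact: agree_trans xy _.
exact: agree_trans (agree_sym xy) _.
Qed.

Lemma open_Sigma11 (O : set baire) : open O -> Sigma11 O.
Proof.
move=> /open_baire_exists ->; apply: Sigma11_existsn => n.
exact: lconst_Sigma11 (@lconst_cylinder n O).
Qed.

(** The sets that are analytic together with their complement form a sigma-algebra containing the
    open sets. *)
Lemma borel_Sigma11 (A : set baire) : borel A -> Sigma11 A.
Proof.
move=> bA; suff [] : Sigma11 A /\ Sigma11 (~` A) by [].
move: A bA; apply: (@smallest_sub _ _ _ [set A : set baire | _]) => /=.
  split=> [|A [? ?]|A h] /=.
  - by rewrite setC0; split; apply: closed_Sigma11; [exact: closed0|exact: closedT].
  - by rewrite setTD setCK.
  - split.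
      have -> : \bigcup_k A k = [set t | exists n, A n t].
        by apply/seteqP; split=> [t [n _ ?]|t [n ?]]; exists n.
      by apply: Sigma11_existsn => n; case: (h n).
    have -> : ~` (\bigcup_k A k) = [set t | forall n, (~` A n) t].
      by apply/seteqP; split=> [t h' n Ant|t h' [n _]]; [apply: h'; exists n|exact: h'].
    by apply: Sigma11_forall => n; case: (h n).
move=> O oO; split; first exact: open_Sigma11.
by apply: closed_Sigma11; rewrite closedC.
Qed.

(** * Lusin separation *)

Section lusin_separation.
Variables (C1 C2 : set baire) (f1 f2 : baire -> baire).

Let img (C : set baire) (f : baire -> baire) (s : seq nat) :=
  [set x | exists u, [/\ C u, agree (size s) (nth 0%N s) u & f u = x]].

Let sep (s t : seq nat) := exists D : set baire,
  [/\ borel D, img C1 f1 s `<=` D & forall x, img C2 f2 t x -> ~ D x].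

Let img_rcons C f s x : img C f s x -> exists n, img C f (rcons s n) x.
Proof.
move=> [u [Cu su fu]]; exists (u (size s)), u; split=> // i.
rewrite size_rcons ltnS leq_eqVlt nth_rcons => /predU1P[->|il].
  by rewrite ltnn eqxx.
by rewrite il su.
Qed.

(** The union over [n] of the intersections over [m] of the separating sets separates the unions of
    the pieces. *)
Let sep_rcons s t : (forall n m, sep (rcons s n) (rcons t m)) -> sep s t.
Proof.
move=> h; have {h}/choice[D hD] : forall p : nat * nat, exists D : set baire,
    [/\ borel D, img C1 f1 (rcons s p.1) `<=` D &
        forall x, img C2 f2 (rcons t p.2) x -> ~ D x] by case=> n m; exact: h.
exists [set x | exists n, forall m, D (n, m) x]; split.
- apply: borel_existsn => n; apply: borel_forall => m.
  by case: (hD (n, m)).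
- move=> x /img_rcons[n hn]; exists n => m.
  by case: (hD (n, m)) => _ + _; apply.
- move=> x /img_rcons[m hm] [n /(_ m)].
  by case: (hD (n, m)) => _ _; apply.
Qed.

(** If separation fails, [sep_rcons] yields branches [u] and [v] all of whose initial segments give
    inseparable pieces. But [f1 u] and [f2 v] differ at some coordinate, which by continuity
    separates small enough pieces. *)
Lemma lusin_separation_image : closed C1 -> closed C2 ->
  continuous f1 -> continuous f2 ->
  (forall u v, C1 u -> C2 v -> f1 u <> f2 v) ->
  exists D, [/\ borel D, (forall u, C1 u -> D (f1 u)) &
                forall v, C2 v -> ~ D (f2 v)].
Proof.
move=> cC1 cC2 cf1 cf2 dis.
suff [D [bD h1 h2]] : sep [::] [::].
  exists D; split=> // [u C1u|v C2v]; first by apply: h1; exists u.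
  by apply: h2; exists v.
apply: contrapT => nsep.
have [|w hw] := @dependent_choice_seq (nat * nat)%type
    (fun s => ~ sep (unzip1 s) (unzip2 s)) nsep.
  move=> s ns; apply: contrapT => /forallNP h; apply: ns; apply: sep_rcons.
  move=> n m; have := h (n, m).
  by rewrite /unzip1 /unzip2 !map_rcons /= => /contrapT.
pose u : baire := fun i => (w i).1; pose v : baire := fun i => (w i).2.
have uE k : unzip1 (mkseq w k) = mkseq u k by rewrite /unzip1 /mkseq -map_comp.
have vE k : unzip2 (mkseq w k) = mkseq v k by rewrite /unzip2 /mkseq -map_comp.
have mk (x : baire) k y : agree (size (mkseq x k)) (nth 0%N (mkseq x k)) y -> agree k x y.
  by rewrite size_mkseq => h i ik; rewrite -h // nth_mkseq.
(* Otherwise some initial segment of [u] has no extension in [C1], and its empty piece is separated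
   by [set0]; dually for [v] with [setT]. *)
have C1u : C1 u.
  apply: closed_agree => // k; apply: contrapT => nk; apply: (hw k).
  exists set0; split=> [|x [y [C1y]]|x _ //]; first exact: sigma_algebra0.
  by rewrite uE => /mk yu _; case: nk; exists y.
have C2v : C2 v.
  apply: closed_agree => // k; apply: contrapT => nk; apply: (hw k).
  exists setT; split=> [|//|x [y [C2y]]]; first exact: lconst_borel (lconst_cst True).
  by rewrite vE => /mk yv _; case: nk; exists y.
have [i hi] : exists i, f1 u i <> f2 v i.
  apply: contrapT => /forallNP h; apply: (dis u v C1u C2v).
  by apply/funext => i; apply: contrapT; exact: h.
move/continuous_baireP: cf1 => /(_ i u)/nbhs_baireP[k1 h1].
move/continuous_baireP: cf2 => /(_ i v)/nbhs_baireP[k2 h2].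
apply: (hw (maxn k1 k2)).
exists [set x | x i = f1 u i]; rewrite uE vE; split.
- by apply: lconst_borel; apply: (lconst_comp (eq^~ _)); exact: lconst_coord.
- move=> x [y [_ /mk uy <-]]; apply: h1.
  by apply: agree_leq uy; rewrite leq_maxl.
- move=> x [y [_ /mk vy <-]] E; apply: hi; rewrite -E; apply: h2.
  by apply: agree_leq vy; rewrite leq_maxr.
Qed.

End lusin_separation.

Lemma lusin_separation (A B : set baire) : Sigma11 A -> Sigma11 B ->
  (forall x, A x -> ~ B x) ->
  exists D, [/\ borel D, A `<=` D & forall x, B x -> ~ D x].
Proof.
move=> [C cC ->] [C' cC' ->] dis.
pose g (u : baire) := (bfst u, bsnd u).
have cg : continuous g.
  by apply: continuous_pair; [exact: bfst_continuous|exact: bsnd_continuous].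
have [||||u v h h'|D [bD h h']] :=
    @lusin_separation_image (g @^-1` C) (g @^-1` C') bfst bfst.
- exact: (proj1 (continuous_closedP g)).
- exact: (proj1 (continuous_closedP g)).
- exact: bfst_continuous.
- exact: bfst_continuous.
- by move=> E; apply: (dis (bfst u)); [exists (bsnd u)|exists (bsnd v); rewrite E].
- exists D; split=> // x [z hz].
    by have := h (bpair x z); rewrite /= /g bfstK bsndK; exact.
  by have := h' (bpair x z); rewrite /= /g bfstK bsndK; exact.
Qed.

(** * Borel codes *)

Definition bcons (a : nat) (x : baire) : baire :=
  fun k => if k is k'.+1 then x k' else a.

Lemma bcons_continuous (T : topologicalType) a (f : T -> baire) :
  continuous f -> continuous (fun t => bcons a (f t)).
Proof.
move=> /continuous_baireP cf; apply/continuous_baireP => -[|i] //=.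
exact: lconst_cst.
Qed.

Section borel_codes.
Context (W : topologicalType) (U : nat -> set W).

Lemma borel_code_bcons1 c A :
  borel_code U c A -> borel_code U (bcons 1 c) (~` A).
Proof. by move=> h; apply: borel_code_compl. Qed.

Lemma borel_code_bcons2 c (A : nat -> set W) :
  (forall n, borel_code U (c n) (A n)) ->
  borel_code U (bcons 2 (pack c)) (\bigcup_n A n).
Proof.
move=> h; apply: borel_code_union => // n.
have -> : code_tail (bcons 2 (pack c)) = pack c by [].
by rewrite packK.
Qed.

(** This makes the final reduction continuous. Codes are built by induction on [A]. An open set is a
    countable union of products of a cylinder and a basic set, and finitely many values of [v]
    decide which of them contribute to the section at [v]. *)
Lemma section_codes (A : set (baire * W)) : basis (range U) -> borel A ->
  exists2 f : baire -> baire, continuous f &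
    forall v, borel_code U (f v) [set w | A (v, w)].
Proof.
move=> bU; move: A.
have [c0 hc0] : exists c, borel_code U c set0.
  by apply/(borel_codeE _ bU); exact: sigma_algebra0.
apply: (@smallest_sub _ _ _ [set A : set (baire * W) |
  exists2 f : baire -> baire, continuous f &
    forall v, borel_code U (f v) [set w | A (v, w)]]) => /=.
  split=> [|A [f cf hf]|A h] /=.
  - by exists (fun=> c0); first exact: cst_continuous.
  - exists (fun v => bcons 1 (f v)); first exact: bcons_continuous.
    move=> v; rewrite (_ : mkset _ = ~` [set w | A (v, w)]).
      exact: borel_code_bcons1.
    by apply/seteqP; split=> [w []|w nA].
  - have {h}/choice[f hf] : forall n, exists f : baire -> baire, continuous f /\
        forall v, borel_code U (f v) [set w | A n (v, w)].
      by move=> n; have [f ? ?] := h n; exists f.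
    exists (fun v => bcons 2 (pack (f^~ v))).
      apply: bcons_continuous; apply: pack_continuous => n.
      by case: (hf n).
    move=> v; have -> : [set w | (\bigcup_k A k) (v, w)] =
        \bigcup_k [set w | A k (v, w)] by [].
    by apply: borel_code_bcons2 => n; case: (hf n).
move=> O oO.
pose Q n k v := forall v', agree n v v' -> forall w, U k w -> O (v', w).
pose g i : nat * nat := odflt (0, 0)%N (unpickle i).
pose bas k : baire := fun j => if j is 0 then 0%N else k.
exists (fun v => bcons 2 (pack (fun i =>
  if pselect (Q (g i).1 (g i).2 v) then bas (g i).2 else c0))).
  apply: bcons_continuous; apply: pack_continuous => i.
  apply/continuous_baireP => j.
  apply: (@lconst_app _ Prop nat (fun P _ => (if pselect P then bas (g i).2 else c0) j)
    (fun v => Q (g i).1 (g i).2 v)) => [|P]; last exact: lconst_cst.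
  exact: (@lconst_cylinder _ [set v' | forall w, U (g i).2 w -> O (v', w)]).
move=> v.
have -> : [set w | O (v, w)] = \bigcup_i
    (if pselect (Q (g i).1 (g i).2 v) then U (g i).2 else set0).
  apply/seteqP; split=> [w Ow|w [i _]]; last first.
    by case: pselect => // h Uw; apply: h Uw; exact: agree_refl.
  have : nbhs (v, w) O by exact: open_nbhs_nbhs.
  move=> [[P1 P2] [/= /nbhs_baireP[n hn] hP2] hO].
  have [_ [[k _ <-] Ukw] UP] := (proj2 bU) w _ hP2.
  exists (pickle (n, k)) => //; rewrite /g pickleK /=.
  case: pselect => // -[] v' vv' w' Uw'.
  by apply: hO; split=> /=; [exact: hn|exact: UP].
apply: borel_code_bcons2 => i; case: pselect => // h.
exact: (@borel_code_basic _ U (bas (g i).2)).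
Qed.

End borel_codes.

Lemma Sigma11_forall_count (T : topologicalType) (I : countType)
    (A : I -> set T) :
  (forall i, Sigma11 (A i)) -> Sigma11 [set t | forall i, A i t].
Proof.
move=> h; have -> : [set t | forall i, A i t] =
    [set t | forall n, (if @unpickle I n is Some i then A i else setT) t].
  apply/seteqP; split=> [t ht n|t ht i]; first by case: unpickle.
  by have := ht (pickle i); rewrite pickleK.
apply: Sigma11_forall => n; case: unpickle => // .
exact: closed_Sigma11 closedT.
Qed.

(* The children of a leaf are the leaf itself, so that every node of a code is
   a code. *)
Definition code_child (c : baire) (n : nat) : baire :=
  if c 0%N == 0%N then c
  else if c 0%N == 1%N then code_tail c else code_nth (code_tail c) n.

(** Sequences are read from their end: the head of [s] is the deepest step, so the children of the
    node [s] are the [n :: s]. *)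
Definition subcode (c : baire) (s : seq nat) : baire :=
  foldr (fun n d => code_child d n) c s.

Fixpoint code_path (k : nat) (c b : baire) : baire :=
  if k is k'.+1 then code_path k' (code_child c (b 0%N)) (code_tail b) else c.

Lemma code_child_continuous (T : topologicalType) (f : T -> baire)
    (n : T -> nat) :
  continuous f -> lconst n -> continuous (fun t => code_child (f t) (n t)).
Proof.
move=> cf cn; have cf' := proj1 (continuous_baireP f) cf.
apply/continuous_baireP => i.
pose h (a m : nat) t := (if a == 0%N then f t i else if a == 1%N then f t i.+1
  else f t ((2 ^ m * i.*2.+1).-1).+1)%N.
have -> : (fun t => code_child (f t) (n t) i) = (fun t => h (f t 0%N) (n t) t).
  apply/funext => t; rewrite /code_child /h.
  by case: ifP => // _; case: ifP.
apply: (@lconst_app _ nat nat (fun a t => h a (n t) t)) => // a.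
apply: (@lconst_app _ nat nat (fun m t => h a m t)) => // m.
by rewrite /h; case: (a == 0%N) => //; case: (a == 1%N).
Qed.

Lemma subcode_continuous s : continuous (fun c => subcode c s).
Proof.
elim: s => [|n s IH]; first exact: id_continuous.
by apply: code_child_continuous; first exact: IH; exact: lconst_cst.
Qed.

Lemma code_path_continuous (T : topologicalType) k (f b : T -> baire) :
  continuous f -> continuous b -> continuous (fun t => code_path k (f t) (b t)).
Proof.
elim: k f b => //= k IH f b cf cb; apply: IH.
  apply: code_child_continuous => //.
  by apply: lconst_at cb (lconst_cst _).
exact: continuous_comp2 cb code_tail_continuous.
Qed.

(** * Analytic evaluation of Borel codes *)

Section evaluation.
Context (W : topologicalType) (U : nat -> set W).

Definition is_code (c : baire) := exists A, borel_code U c A.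

Lemma borel_code_child c A n :
  borel_code U c A -> is_code (code_child c n).
Proof.
rewrite /code_child; case=> {A}[{}c c0|{}c A c0 hA|{}c A c0 hA].
- by rewrite c0 eqxx; exists (U (c 1%N)); exact: borel_code_basic.
- by rewrite c0 /=; exists A.
- case: ifP => [/eqP E|_]; first by rewrite E in c0.
  case: ifP => [/eqP E|_]; first by rewrite E in c0.
  by exists (A n).
Qed.

Lemma is_code_sub c s : is_code c -> is_code (subcode c s).
Proof. by move=> hc; elim: s => //= n s [A]; exact: borel_code_child. Qed.

Lemma not_is_code_child c : ~ is_code c ->
  c 0%N <> 0%N /\ exists n, ~ is_code (code_child c n).
Proof.
move=> nc; have c0 : c 0%N <> 0%N.
  by move=> c0; apply: nc; exists (U (c 1%N)); exact: borel_code_basic.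
split=> //; apply: contrapT => /forallNP h; apply: nc.
have {}h n : is_code (code_child c n) by apply: contrapT; exact: h.
move: h; rewrite /code_child (negPf (introN eqP c0)).
case: eqP => [c1 /(_ 0%N)[A hA]|c1 /choice[A hA]].
  by exists (~` A); exact: borel_code_compl.
exists (\bigcup_n A n); apply: borel_code_union => //.
by case: (c 0%N) c0 c1 => [|[|]].
Qed.

(** Codes are well-founded trees, so a point that is no code has an infinite path [b] that never
    meets a leaf. *)
Lemma not_is_codeP c :
  ~ is_code c <-> exists b, forall k, code_path k c b 0%N <> 0%N.
Proof.
split=> [nc|[b hb] [A hA]].
  have /choice[nx nxP] : forall d, exists n, ~ is_code d -> ~ is_code (code_child d n).
    move=> d; have [?|/not_is_code_child[_ [n ?]]] := pselect (is_code d).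
      by exists 0%N.
    by exists n.
  pose step d := code_child d (nx d).
  exists (fun k => nx (iter k step c)) => k.
  elim: k c nc => [|k IH] c nc; first by case: (not_is_code_child nc).
  rewrite /=; have := IH (step c) (nxP _ nc).
  have -> // : (fun k => nx (iter k step (step c))) =
    code_tail (fun k => nx (iter k step c)).
  by apply/funext => j; rewrite /code_tail iterSr.
elim: hA b hb => {c A}.
- by move=> c c0 b /(_ 0%N).
- move=> c A c0 _ IH b hb; apply: (IH (code_tail b)) => k.
  by have := hb k.+1; rewrite /= /code_child c0.
- move=> c A c0 _ IH b hb; apply: (IH (b 0%N) (code_tail b)) => k.
  have := hb k.+1; rewrite /= /code_child.
  by case: (c 0%N) c0 => [|[|]].
Qed.

Lemma not_is_code_Sigma11 : Sigma11 [set c | ~ is_code c].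
Proof.
have -> : [set c | ~ is_code c] =
    [set c | exists b, forall k, code_path k c b 0%N <> 0%N].
  by apply/seteqP; split=> c /not_is_codeP.
exists [set p | forall k, code_path k p.1 p.2 0%N <> 0%N] => //.
apply: closed_forall => k; apply: lconst_closed.
apply: (lconst_comp (fun n : nat => n <> 0%N)).
move: 0%N; apply/continuous_baireP; apply: code_path_continuous.
  exact: fst_continuous.
exact: snd_continuous.
Qed.

(** [val] claims for each node whether [w] belongs to the set coded there; this is the local rule at
    [s] for a leaf, a complement or a union. *)
Definition consistent (c : baire) (w : W) (val : baire) (s : seq nat) :=
  let v t := val (pickle t) in let d := subcode c s in
  (d 0%N = 0%N /\
    ((v s = 1%N /\ U (d 1%N) w) \/ (v s = 0%N /\ ~ U (d 1%N) w))) \/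
  (d 0%N = 1%N /\
    ((v s = 1%N /\ v (0%N :: s) = 0%N) \/ (v s = 0%N /\ v (0%N :: s) = 1%N))) \/
  ((2 <= d 0%N)%N /\
    ((v s = 1%N /\ exists n, v (n :: s) = 1%N) \/
     (v s = 0%N /\ forall n, v (n :: s) = 0%N))).

(** Membership and non-membership both become analytic in this way, and on codes they are
    complementary. *)
Definition evaluates (b : nat) (c : baire) (w : W) :=
  exists val, val (pickle ([::] : seq nat)) = b /\
              forall s, consistent c w val s.

(** By induction on the code, the local rules force the truth values. *)
Lemma consistentP c w val s A : (forall s, consistent c w val s) ->
  borel_code U (subcode c s) A ->
  (val (pickle s) = 1%N /\ A w) \/ (val (pickle s) = 0%N /\ ~ A w).
Proof.
move=> hval; move E : (subcode c s) => d hA.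
elim: hA s E => {d A} [d d0 s E|d A d0 _ IH s E|d A d0 _ IH s E].
- have := hval s; rewrite /consistent E d0.
  by case=> [[_ []]|[[]|[]]] //; [left|right].
- have := IH (0%N :: s); rewrite /= E /code_child d0 /= => /(_ erefl) h.
  have := hval s; rewrite /consistent E d0.
  case=> [[]//|[[_ h']|[]//]].
  move: h' h => [] [-> ->] [] [] // _ Aw; first by left.
  by right; split=> // nA; exact: nA.
- have h n : (val (pickle (n :: s)) = 1%N /\ A n w) \/
             (val (pickle (n :: s)) = 0%N /\ ~ A n w).
    by apply: IH; rewrite /= E /code_child; case: (d 0%N) d0 => [|[|]].
  have := hval s; rewrite /consistent E.
  case=> [[d0']|[[d0']|[_ []]]]; rewrite ?d0' // in d0 *.
  + move=> [-> [n vn]]; left; split=> //.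
    by exists n => //; case: (h n) => -[] //; rewrite vn.
  + move=> [-> vn]; right; split=> // -[n _].
    by case: (h n) => -[] //; rewrite vn.
Qed.

Lemma consistent_exists c w : is_code c ->
  exists val, forall s, consistent c w val s.
Proof.
move=> hc.
pose V s := exists A, borel_code U (subcode c s) A /\ A w.
have VP s A : borel_code U (subcode c s) A -> (V s <-> A w).
  move=> hA; split=> [[B [hB Bw]]|Aw]; last by exists A.
  by rewrite (borel_code_inj hA hB).
have [val vE] : exists val : baire, forall s, val (pickle s) = `[<V s>].
  exists (fun n => nat_of_bool `[<V (odflt [::] (unpickle n))>]) => s.
  by rewrite pickleK.
exists val => s; rewrite /consistent !vE; have [A hA] := is_code_sub s hc.
have VA := VP _ _ hA; move E : (subcode c s) hA => d hA.
case: hA E VA => {d A} [d d0|d A d0 hA|d A d0 hA] E VA.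
- left; split=> //; have [Vs|nVs] := pselect (V s).
    by left; rewrite asboolT //; split=> //; apply/VA.
  by right; rewrite asboolF //; split=> // /VA.
- have V0 : V (0%N :: s) <-> A w by apply: VP; rewrite /= E /code_child d0.
  right; left; split=> //.
  have [Vs|nVs] := pselect (V s).
    left; rewrite asboolT // asboolF //.
    by move=> /V0 Aw; apply: (proj1 VA Vs).
  right; rewrite asboolF // asboolT //; apply/V0; apply: contrapT => nA.
  by apply: nVs; apply/VA.
- have Vn n : V (n :: s) <-> A n w.
    apply: VP; rewrite /= E /code_child.
    by case: (d 0%N) d0 => [|[|k]] // _; exact: hA.
  right; right; split=> //.
  have [Vs|nVs] := pselect (V s).
    left; rewrite asboolT //; split=> //.
    have [n _ An] := proj1 VA Vs.
    by exists n; rewrite vE asboolT //; apply/Vn.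
  right; rewrite asboolF //; split=> // n; rewrite vE asboolF //.
  by move=> /Vn An; apply: nVs; apply/VA; exists n.
Qed.

Lemma evaluates1P c A w : borel_code U c A -> (evaluates 1 c w <-> A w).
Proof.
move=> hA; split=> [[val [v1 hval]]|Aw].
  by have [[]|[]] := consistentP (s := [::]) hval hA; rewrite ?v1.
have [|val hval] := @consistent_exists c w; first by exists A.
exists val; split=> //.
by have [[]|[]] := consistentP (s := [::]) hval hA.
Qed.

Lemma evaluates0P c A w : borel_code U c A -> (evaluates 0 c w <-> ~ A w).
Proof.
move=> hA; split=> [[val [v0 hval]]|Aw].
  by have [[]|[]] := consistentP (s := [::]) hval hA; rewrite ?v0.
have [|val hval] := @consistent_exists c w; first by exists A.
exists val; split=> //.
by have [[]|[]] := consistentP (s := [::]) hval hA.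
Qed.

(** The points of [W] are taken through a continuous [q] because [open_Sigma11] concerns open
    subsets of the Baire space. *)
Lemma evaluates_Sigma11 (T : topologicalType) (q : baire -> W) b
    (f g : T -> baire) :
  (forall n, open (U n)) -> continuous q -> continuous f -> continuous g ->
  Sigma11 [set t | evaluates b (f t) (q (g t))].
Proof.
move=> oU cq cf cg.
suff h : Sigma11 [set p : baire * baire | evaluates b p.1 (q p.2)].
  by have := Sigma11_preimage (continuous_pair cf cg) h.
have cc s : continuous (fun p : baire * baire * baire => subcode p.1.1 s).
  apply: continuous_comp2 (@subcode_continuous s).
  exact: continuous_comp2 (@fst_continuous _ _) (@fst_continuous _ _).
have cd s i : lconst (fun p : baire * baire * baire => subcode p.1.1 s i).
  by move: i; apply/continuous_baireP.
have cv n : lconst (fun p : baire * baire * baire => p.2 n).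
  by move: n; apply/continuous_baireP; exact: snd_continuous.
have cw : continuous (fun p : baire * baire * baire => p.1.2).
  exact: continuous_comp2 (@fst_continuous _ _) (@snd_continuous _ _).
have oq n : open (q @^-1` U n) by move/continuousP: cq; apply.
have eqv n (k : nat) : Sigma11 [set p : baire * baire * baire | p.2 n = k].
  by apply: lconst_Sigma11; exact: (lconst_comp (eq^~ k)).
have eqd s i (k : nat) :
    Sigma11 [set p : baire * baire * baire | subcode p.1.1 s i = k].
  by apply: lconst_Sigma11; exact: (lconst_comp (eq^~ k)).
apply: (@Sigma11_proj _ [set p : baire * baire * baire |
  p.2 (pickle ([::] : seq nat)) = b /\
  forall s, consistent p.1.1 (q p.1.2) p.2 s]).
apply: Sigma11_and; first exact: eqv.
apply: (@Sigma11_forall_count _ (seq nat : countType)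
  (fun s p => consistent p.1.1 (q p.1.2) p.2 s)) => s.
apply: Sigma11_or; last apply: Sigma11_or; apply: Sigma11_and.
- exact: eqd.
- apply: Sigma11_or; (apply: Sigma11_and; first exact: eqv).
    (* The index of the basic set depends on the code, hence a split over its countably many
       values. *)
    have -> : (fun p : baire * baire * baire => U (subcode p.1.1 s 1) (q p.1.2))
      = [set p | exists n, subcode p.1.1 s 1 = n /\ U n (q p.1.2)].
      by apply/seteqP; split=> [p Up|p [n [-> //]]]; exists (subcode p.1.1 s 1).
    apply: Sigma11_existsn => n; apply: Sigma11_and; first exact: eqd.
    exact: (Sigma11_preimage cw (open_Sigma11 (oq n))).
  have -> : (fun p : baire * baire * baire => ~ U (subcode p.1.1 s 1) (q p.1.2))
      = [set p | exists n, subcode p.1.1 s 1 = n /\ ~ U n (q p.1.2)].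
    by apply/seteqP; split=> [p Up|p [n [-> //]]]; exists (subcode p.1.1 s 1).
  apply: Sigma11_existsn => n; apply: Sigma11_and; first exact: eqd.
  have cl : closed (~` (q @^-1` U n)) by rewrite closedC.
  exact: (Sigma11_preimage cw (closed_Sigma11 cl)).
- exact: eqd.
- by apply: Sigma11_or; apply: Sigma11_and; exact: eqv.
- by apply: lconst_Sigma11; apply: (lconst_comp (fun n => is_true (1 < n)%N)).
- apply: Sigma11_or; (apply: Sigma11_and; first exact: eqv).
    by apply: Sigma11_existsn => n; exact: eqv.
  by apply: Sigma11_forall => n; exact: eqv.
Qed.

End evaluation.

(** * Polish spaces as images of the Baire space *)

Lemma second_countable_enum (T : topologicalType) : @second_countable T ->
  exists O : nat -> set T, (forall n, open (O n)) /\
    forall x A, nbhs x A -> exists n, O n x /\ O n `<=` A.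
Proof.
move=> [B /countable_injP[f injf] [oB bB]].
(* By injectivity of [f] this is the basic set of number [n] if there is one, and the empty set
   otherwise. *)
exists (fun n => \bigcup_(b in [set b | B b /\ f b = n]) b); split.
  by move=> n; apply: bigcup_open => b [/oB].
move=> x A /(bB x)[b [Bb bx] bA]; exists (f b); split; first by exists b.
move=> y [b' [Bb' E] b'y]; apply: bA; suff <- : b' = b by [].
by apply: injf E; rewrite inE.
Qed.

Section polish_spaces.
Local Open Scope ring_scope.
Import GRing.Theory Num.Theory.
Variables (R : realType) (X : topologicalType).
Hypothesis polX : polish R X.

Let eps (k : nat) : R := (2^-1) ^+ k.

Let epsS k : eps k.+1 + eps k.+1 = eps k.
Proof. by rewrite /eps exprS; lra. Qed.

Let eps_gt0 k : 0 < eps k.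
Proof. by rewrite exprn_gt0 // invr_gt0. Qed.

Let eps_small e : 0 < e -> exists k, eps k < e.
Proof.
move=> e0; pose k := Num.bound e^-1; exists k.
have h : e^-1 < k%:R by apply: archi_boundP; rewrite invr_ge0 ltW.
rewrite /eps exprVn -[ltRHS]invrK ltf_pV2 ?posrE ?invr_gt0 ?exprn_gt0 //.
by apply: lt_trans h _; rewrite -natrX ltr_nat ltn_expl.
Qed.

Lemma polish_open_neq : open [set p : X * X | p.1 <> p.2].
Proof.
move: polX => [_ [d [d0 dC dT nd _]]].
rewrite openE => -[x y] /= xy.
have dge a b : 0 <= d a b.
  by have := dT a b a; rewrite (proj2 (d0 a a) erefl) (dC b a); lra.
have dxy : 0 < d x y.
  by rewrite lt_neqAle dge andbT eq_sym; apply/eqP => /d0.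
exists ([set z | d x z < d x y / 2], [set z | d y z < d x y / 2]) => /=.
  by split; apply/nd; exists (d x y / 2) => //; lra.
move=> [z w] /= [h1 h2] E; rewrite E in h1.
by have := dT x w y; rewrite (dC w y); lra.
Qed.

(** A point [z] lists indices in a dense sequence [q]. A move of length at least [eps k] is ignored
    at step [k], so that every [z] yields a fast Cauchy sequence [xs z], whose limit is [g z]. *)
Lemma polish_surjection : (exists _ : X, True) ->
  exists2 g : baire -> X, continuous g & forall x, exists z, g z = x.
Proof.
move=> [x0 _]; move: polX => [sc [d [d0 dC dT nd cX]]].
have dge a b : 0 <= d a b.
  by have := dT a b a; rewrite (proj2 (d0 a a) erefl) (dC b a); lra.
have [O [_ hO]] := second_countable_enum sc.
have /choice[q hq] : forall n, exists x, (exists y, O n y) -> O n x.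
  move=> n; have [[y Oy]|nO] := pselect (exists y, O n y); first by exists y.
  by exists x0.
have dense x e : 0 < e -> exists n, d x (q n) < e.
  move=> e0; have : nbhs x [set y | d x y < e] by apply/nd; exists e.
  by move/hO => [n [Ox Oe]]; exists n; apply: Oe; apply: hq; exists x.
pose xs := fix xs (z : baire) k : X := if k is k'.+1 then
  if d (xs z k') (q (z k)) < eps k' then q (z k) else xs z k' else q (z 0%N).
have xsS z k : d (xs z k) (xs z k.+1) <= eps k.
  rewrite /=; case: ifP => [/ltW//|_].
  by rewrite (proj2 (d0 _ _) erefl) ltW.
(* The right-hand side is the geometric sum of the [eps i] for [i] from [k] to [k + j - 1]. *)
have xsD z k j : d (xs z k) (xs z (k + j)%N) <= 2 * eps k - 2 * eps (k + j)%N.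
  elim: j => [|j IH]; first by rewrite addn0 (proj2 (d0 _ _) erefl); lra.
  rewrite addnS; have := dT (xs z k) (xs z (k + j)%N) (xs z (k + j).+1).
  by have := xsS z (k + j)%N; have := epsS (k + j)%N; lra.
have xsB z k m : (k <= m)%N -> d (xs z k) (xs z m) <= 2 * eps k.
  move=> km; have := xsD z k (m - k)%N; rewrite subnKC // => h.
  by have := eps_gt0 m; lra.
pose lim_xs (z : baire) (l : X) := xs z @ \oo --> l.
have /choice[g hg] : forall z, exists l, lim_xs z l.
  move=> z; apply: cX => e e0; have [N hN] := @eps_small (e / 4) ltac:(lra).
  exists N => m n Nm Nn; have := dT (xs z m) (xs z N) (xs z n).
  by have := xsB z N m Nm; have := xsB z N n Nn; rewrite (dC (xs z m) (xs z N)); lra.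
have gB z k : d (xs z k) (g z) <= 3 * eps k.
  have : nbhs (g z) [set y | d (g z) y < eps k] by apply/nd; exists (eps k).
  move=> /(hg z)[N _ hN]; have := hN (maxn N k) (leq_maxl _ _) => /= h.
  have := xsB z k (maxn N k) (leq_maxr _ _).
  have := dT (xs z k) (xs z (maxn N k)) (g z).
  by rewrite (dC (xs z (maxn N k)) (g z)); lra.
have xsA z z' k : agree k.+1 z z' -> xs z k = xs z' k.
  elim: k => [|k IH] h; first by rewrite /= h.
  by rewrite /= IH ?h //; exact: agree_leq h.
exists g.
  move=> z A /nd[e e0 eA]; have [k hk] := @eps_small (e / 6) ltac:(lra).
  change (nbhs z (g @^-1` A)); apply/nbhs_baireP; exists k.+1 => z' zz'.
  apply: eA => /=; have := dT (g z) (xs z k) (g z').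
  have := gB z k; have := gB z' k; rewrite -(xsA _ _ _ zz') (dC (g z) (xs z k)).
  by have := eps_gt0 k; lra.
(* With this accuracy every move is accepted, as [eps k.+1 + eps k.+2 < eps k]. *)
move=> x; have /choice[z hz] : forall k, exists n, d x (q n) < eps k.+1.
  by move=> k; exact: dense.
exists z; have xsE k : xs z k = q (z k).
  elim: k => //= k ->; rewrite ifT //.
  have := dT (q (z k)) x (q (z k.+1)); rewrite (dC _ x).
  by have := hz k; have := hz k.+1; have := epsS k; have := epsS k.+1;
     have := eps_gt0 k.+2; lra.
apply/d0; apply/eqP; apply: contrapT => /negP dn0.
have dp : 0 < d (g z) x by rewrite lt_neqAle dge andbT eq_sym.
have [k hk] := @eps_small (d (g z) x / 4) ltac:(lra).
have := dT (g z) (xs z k) x; rewrite (dC (g z) (xs z k)) (dC (xs z k) x).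
by have := gB z k; have := hz k; rewrite -xsE; have := epsS k;
   have := eps_gt0 k.+1; lra.
Qed.

End polish_spaces.

(** * Hyperfiniteness witnesses *)

(* Evidence that the relations F n, of which P1 n i j and P0 n i j assert
   (p i, p j) \in F n and (p i, p j) \notin F n, are not an increasing sequence
   of equivalence relations with finite classes on the family p. *)
Definition bad_pattern (P1 P0 : nat -> nat -> nat -> Prop)
    (N : nat -> nat -> Prop) :=
  (exists n i, P0 n i i) \/ (exists n i j, P1 n i j /\ P0 n j i) \/
  (exists n i j k, P1 n i j /\ (P1 n j k /\ P0 n i k)) \/
  (exists n i j, P1 n i j /\ P0 n.+1 i j) \/
  (exists n, (forall i, P1 n 0%N i.+1) /\
     (forall i j, i <> j -> N i.+1 j.+1)).

(** [bad_pattern] takes a relation and its negation separately so that both can be replaced by the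
    analytic [evaluates]; here they are true complements. *)
Definition bad_family (T : Type) (F : nat -> set (T * T)) (p : nat -> T) :=
  bad_pattern (fun n i j => F n (p i, p j)) (fun n i j => ~ F n (p i, p j))
    (fun i j => p i <> p j).

Lemma Sigma11_impl (T : topologicalType) (P : Prop) (A : set T) :
  (P -> Sigma11 A) -> Sigma11 [set t | P -> A t].
Proof.
move=> h; have [/[dup] Pp /h|nP] := pselect P.
  suff -> : [set t | P -> A t] = A by [].
  by apply/seteqP; split=> t /= ?; auto.
have -> : [set t | P -> A t] = setT.
  by apply/seteqP; split=> // t _ /nP.
exact: closed_Sigma11 closedT.
Qed.

Lemma bad_pattern_Sigma11 (T : topologicalType)
    (P1 P0 : T -> nat -> nat -> nat -> Prop) (N : T -> nat -> nat -> Prop) :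
  (forall n i j, Sigma11 [set t | P1 t n i j]) ->
  (forall n i j, Sigma11 [set t | P0 t n i j]) ->
  (forall i j, Sigma11 [set t | N t i j]) ->
  Sigma11 [set t | bad_pattern (P1 t) (P0 t) (N t)].
Proof.
move=> h1 h0 hN; rewrite /bad_pattern.
apply: Sigma11_or.
  by apply: Sigma11_existsn => n; apply: Sigma11_existsn => i; exact: h0.
apply: Sigma11_or.
  apply: Sigma11_existsn => n; apply: Sigma11_existsn => i.
  apply: Sigma11_existsn => j; apply: Sigma11_and; [exact: h1|exact: h0].
apply: Sigma11_or.
  apply: Sigma11_existsn => n; apply: Sigma11_existsn => i.
  apply: Sigma11_existsn => j; apply: Sigma11_existsn => k.
  by apply: Sigma11_and; [exact: h1|apply: Sigma11_and; [exact: h1|exact: h0]].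
apply: Sigma11_or.
  apply: Sigma11_existsn => n; apply: Sigma11_existsn => i.
  apply: Sigma11_existsn => j; apply: Sigma11_and; [exact: h1|exact: h0].
apply: Sigma11_existsn => n; apply: Sigma11_and.
  by apply: Sigma11_forall => i; exact: h1.
apply: Sigma11_forall => i; apply: Sigma11_forall => j.
by apply: Sigma11_impl => _; exact: hN.
Qed.

Lemma bad_pattern_equiv P1 P1' P0 P0' N :
  (forall n i j, P1 n i j <-> P1' n i j) ->
  (forall n i j, P0 n i j <-> P0' n i j) ->
  bad_pattern P1 P0 N = bad_pattern P1' P0' N.
Proof.
move=> h1 h0; have -> : P1 = P1'.
  by apply/funext => n; apply/funext => i; apply/funext => j; exact/propext.
have -> // : P0 = P0'.
by apply/funext => n; apply/funext => i; apply/funext => j; exact/propext.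
Qed.

Lemma not_bad_family (T : topologicalType) (D : set T) (F : nat -> set (T * T))
    (p : nat -> T) :
  (forall n, equivalence_on D (F n)) ->
  (forall n x, finite_set [set y | F n (x, y)]) ->
  (forall n, F n `<=` F n.+1) -> (forall i, D (p i)) -> ~ bad_family F p.
Proof.
move=> eF fF iF Dp [[n [i]]|[[n [i [j []]]]|[[n [i [j [k [h1 [h2]]]]]]|
  [[n [i [j []]]]|[n [h inj]]]]]].
- by case: (eF n) => _ rF _ _; apply; exact: rF.
- by case: (eF n) => _ _ sF _ /sF.
- by case: (eF n) => _ _ _ tF; apply; exact: tF h1 h2.
- by move=> /iF.
- suff : finite_set [set: nat] by exact: infinite_nat.
  have := @finite_preimage _ _ [set y | F n (p 0%N, y)] (fun i => p i.+1).
  have -> : (fun i => p i.+1) @^-1` [set y | F n (p 0%N, y)] = setT.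
    by apply/seteqP; split=> // i _; exact: h.
  apply=> // i j _ _ E; apply: contrapT => ij; exact: inj ij E.
Qed.

Lemma infinite_injection (T : choiceType) (A : set T) : infinite_set A ->
  exists f : nat -> T, (forall i, A (f i)) /\ injective f.
Proof.
move=> infA.
have [|s [uni sA]|f hf] := @dependent_choice_seq T
    (fun s => uniq s /\ [set` s] `<=` A); first by split=> // x.
  have [a [Aa sa]] : exists a, A a /\ a \notin s.
    apply: contrapT => /forallNP h; apply: infA.
    apply: (@sub_finite_set _ _ [set` s]); last exact: finite_seq.
    by move=> a Aa; apply: contrapT => /negP ns; apply: (h a).
  exists a; rewrite rcons_uniq sa; split=> // x.
  by rewrite /= mem_rcons in_cons => /predU1P[->|/sA].
exists f; split=> [i|i j E].
  case: (hf i.+1) => _; apply; rewrite /= mkseqS mem_rcons.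
  exact: mem_head.
have [uni _] := hf (maxn i j).+1.
apply/eqP; rewrite -(nth_uniq (f 0%N) _ _ uni) ?size_mkseq ?ltnS ?leq_maxl
  ?leq_maxr // !nth_mkseq ?ltnS ?leq_maxl ?leq_maxr //.
exact/eqP.
Qed.

(** Converse of [not_bad_family]: a failure of the conclusion involves at most three points, or an
    infinite class, inside one class of [Q], and listing these points gives a bad family. *)
Lemma good_family (T : topologicalType) (D : set T) (Q : set (T * T))
    (F : nat -> set (T * T)) : equivalence_on D Q ->
  (forall p, (forall i j, Q (p i, p j)) -> ~ bad_family F p) ->
  [/\ forall n, equivalence_on D (F n `&` Q),
      forall n x, finite_set [set y | (F n `&` Q) (x, y)] &
      forall n, F n `&` Q `<=` F n.+1 `&` Q].
Proof.
move=> [QD Qr Qs Qt] nbad; split.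
- move=> n; split.
  + by move=> x [_ /QD].
  + move=> x Dx; split; last exact: Qr.
    apply: contrapT => nF; apply: (nbad (fun=> x)); first by move=> *; exact: Qr.
    by left; exists n, 0%N.
  + move=> x y [Fxy Qxy]; split; last exact: Qs.
    apply: contrapT => nF.
    apply: (nbad (fun i => if i is 0%N then x else y)); last first.
      by right; left; exists n, 0%N, 1%N.
    have [Dx Dy] := QD _ Qxy.
    by move=> [|i] [|j] //; [exact: Qr|exact: Qs|exact: Qr].
  + move=> x y z [Fxy Qxy] [Fyz Qyz]; split; last exact: Qt Qxy Qyz.
    apply: contrapT => nF.
    pose p i := if i is i'.+1 then if i' is 0%N then y else z else x.
    apply: (nbad p); last by right; right; left; exists n, 0%N, 1%N, 2%N.
    have [Dx Dy] := QD _ Qxy; have [_ Dz] := QD _ Qyz.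
    have Qxp i : Q (x, p i).
      by case: i => [|[|i]] //=; [exact: Qr|exact: Qt Qxy Qyz].
    by move=> i j; apply: Qt (Qxp j); exact/Qs.
- move=> n x; apply: contrapT => /infinite_injection[f [fA finj]].
  apply: (nbad (fun i => if i is i'.+1 then f i' else x)).
    have Qxp i : Q (x, f i) by case: (fA i).
    have Qx : Q (x, x) by apply: Qr; case: (QD _ (Qxp 0%N)).
    move=> [|i] [|j] //; first exact: Qs.
    by apply: Qt (Qxp j); exact/Qs.
  right; right; right; right; exists n; split=> [i|i j ij E].
    by case: (fA i).
  by apply: ij; exact: finj.
- move=> n [x y] [Fxy Qxy]; split=> //; apply: contrapT => nF.
  apply: (nbad (fun i => if i is 0%N then x else y)); last first.
    by right; right; right; left; exists n, 0%N, 1%N.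
  have [Dx Dy] := QD _ Qxy.
  by move=> [|i] [|j] //; [exact: Qr|exact: Qs|exact: Qr].
Qed.

Lemma hyperfinite_bigcup (T : topologicalType) (D : set T)
    (F : nat -> set (T * T)) :
  (forall n, borel_equivalence_on D (F n)) ->
  (forall n x, finite_set [set y | F n (x, y)]) ->
  (forall n, F n `<=` F n.+1) -> hyperfinite_on D (\bigcup_n F n).
Proof.
move=> eF fF iF; split; last by exists F.
split; last first.
  move=> x; have -> : [set y | (\bigcup_n F n) (x, y)] =
    \bigcup_n [set y | F n (x, y)] by [].
  by apply: bigcup_countable => // n _; exact: finite_set_countable.
split; last by apply: sigma_algebra_bigcup => n; case: (eF n).
split.
- by move=> p [n _ Fp]; case: (eF n) => -[h _ _ _] _; exact: h.
- by move=> x Dx; exists 0%N => //; case: (eF 0%N) => -[_ h _ _] _; exact: h.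
- by move=> x y [n _ Fxy]; exists n => //; case: (eF n) => -[_ _ h _] _; exact: h.
- have mono m n : (m <= n)%N -> F m `<=` F n.
    move=> /subnK <-; elim: (n - m)%N => // k IH; rewrite addSn.
    exact: subset_trans IH (iF _).
  move=> x y z [m _ Fxy] [n _ Fyz]; exists (maxn m n) => //.
  case: (eF (maxn m n)) => -[_ _ _ h] _; apply: (h x y z).
    by apply: mono Fxy; rewrite leq_maxl.
  by apply: mono Fyz; rewrite leq_maxr.
Qed.

(** * The upper bound *)

Section upper_bound.
Variables (X : topologicalType) (U : nat -> set (X * X)).
Hypothesis bU : basis (range U).

Let oU n : open (U n). Proof. by case: bU => h _; apply: h; exists n. Qed.

(** An empty [X] is no image of the Baire space, but then every coded relation is hyperfinite and
    only the coanalytic set of codes remains. *)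
Lemma hyperfinite_codes_empty : ~ (exists _ : X, True) ->
  Sigma12 (hyperfinite_codes U).
Proof.
move=> nX; have X0 (x : X) : False by apply: nX; exists x.
exists [set p | is_code U p.1].
  have := Sigma11_preimage (@fst_continuous baire baire) (@not_is_code_Sigma11 _ U).
  by [].
apply/seteqP; split=> [c [E hE _]|c [_ /= [E hE]]].
  by exists (fun=> 0%N); exists E.
exists E => //; have bE : borel E by apply/(borel_codeE _ bU); exists c.
have eqE : equivalence_on setT E.
  by split; [by []|by move=> x; case: (X0 x)..].
have fE x : finite_set [set y | E (x, y)] by case: (X0 x).
split; first by split=> // x; case: (X0 x).
exists (fun=> E); split; [by move=> n; split|by move=> n x; exact: fE|by move=> n p|].
by apply/seteqP; split=> [p Ep|p [_ _]] //; exists 0%N.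
Qed.

Variables (g : baire -> X).
Hypotheses (cg : continuous g) (sg : forall x, exists z, g z = x).
Hypothesis neqX : open [set p : X * X | p.1 <> p.2].

Let point (a : baire) i := g (code_nth a i).

(** The family packed in [a] refutes the sequence of relations packed in [d] as a witness for the
    relation coded by [c]: the sequence is bad, or its union is too small or too large. *)
Let bad_witness (c d a : baire) :=
  bad_pattern (fun n i j => evaluates U 1 (code_nth d n) (point a i, point a j))
    (fun n i j => evaluates U 0 (code_nth d n) (point a i, point a j))
    (fun i j => point a i <> point a j) \/
  (evaluates U 1 c (point a 0%N, point a 1%N) /\
    forall n, evaluates U 0 (code_nth d n) (point a 0%N, point a 1%N)) \/
  (evaluates U 0 c (point a 0%N, point a 1%N) /\
    exists n, evaluates U 1 (code_nth d n) (point a 0%N, point a 1%N)).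

Let bad_witness_Sigma11 :
  Sigma11 [set t : baire * baire * baire | bad_witness t.1.1 t.1.2 t.2].
Proof.
pose q b := (g (bfst b), g (bsnd b)).
have cq : continuous q.
  by apply: continuous_pair; apply: continuous_comp2 cg;
     [exact: bfst_continuous|exact: bsnd_continuous].
have ca i : continuous (fun t : baire * baire * baire => code_nth t.2 i).
  by apply: continuous_comp2 (@code_nth_continuous i); exact: snd_continuous.
pose r i j (t : baire * baire * baire) := bpair (code_nth t.2 i) (code_nth t.2 j).
have cr i j : continuous (r i j) by exact: bpair_continuous.
have qr i j t : (point t.2 i, point t.2 j) = q (r i j t).
  by rewrite /q /r bfstK bsndK.
have ev b (f : baire * baire * baire -> baire) i j : continuous f ->
    Sigma11 [set t | evaluates U b (f t) (point t.2 i, point t.2 j)].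
  move=> cf; have -> : [set t | evaluates U b (f t) (point t.2 i, point t.2 j)] =
    [set t | evaluates U b (f t) (q (r i j t))].
    by apply/seteqP; split=> t /=; rewrite qr.
  exact: evaluates_Sigma11.
have cc : continuous (fun t : baire * baire * baire => t.1.1).
  exact: continuous_comp2 (@fst_continuous _ _) (@fst_continuous _ _).
have cd n : continuous (fun t : baire * baire * baire => code_nth t.1.2 n).
  apply: continuous_comp2 (@code_nth_continuous n).
  exact: continuous_comp2 (@fst_continuous _ _) (@snd_continuous _ _).
apply: Sigma11_or; last apply: Sigma11_or.
- apply: bad_pattern_Sigma11 => [n i j|n i j|i j]; [exact: ev|exact: ev|].
  have -> : [set t : baire * baire * baire | point t.2 i <> point t.2 j] =
      r i j @^-1` (q @^-1` [set p : X * X | p.1 <> p.2]).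
    by apply/seteqP; split=> t; rewrite /= /r bfstK bsndK.
  apply: Sigma11_preimage => //; apply: open_Sigma11.
  by move/continuousP: cq; apply.
- apply: Sigma11_and; first exact: ev.
  by apply: Sigma11_forall => n; exact: ev.
- apply: Sigma11_and; first exact: ev.
  by apply: Sigma11_existsn => n; exact: ev.
Qed.

Let bad_witnessP c d a E F : borel_code U c E ->
  (forall n, borel_code U (code_nth d n) (F n)) ->
  bad_witness c d a <-> (bad_family F (point a) \/
    (E (point a 0%N, point a 1%N) /\ forall n, ~ F n (point a 0%N, point a 1%N)) \/
    (~ E (point a 0%N, point a 1%N) /\ exists n, F n (point a 0%N, point a 1%N))).
Proof.
move=> hE hF.
have e1 n w := evaluates1P w (hF n); have e0 n w := evaluates0P w (hF n).
have c1 w := evaluates1P w hE; have c0 w := evaluates0P w hE.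
rewrite /bad_witness /bad_family.
rewrite (@bad_pattern_equiv _ (fun n i j => F n (point a i, point a j)) _
  (fun n i j => ~ F n (point a i, point a j))) //.
split.
  case=> [|[[/c1 ? h]|[/c0 ? [n /e1 ?]]]]; [by left| |].
    by right; left; split=> // n; apply/e0.
  by right; right; split=> //; exists n.
case=> [|[[/c1 ? h]|[/c0 ? [n /e1 ?]]]]; [by left| |].
  by right; left; split=> // n; apply/e0.
by right; right; split=> //; exists n.
Qed.

Lemma hyperfinite_codes_nonempty : Sigma12 (hyperfinite_codes U).
Proof.
exists [set p | ~ (~ is_code U p.1 \/ (exists n, ~ is_code U (code_nth p.2 n)) \/
                   exists a, bad_witness p.1 p.2 a)].
  rewrite /Pi11 (_ : ~` _ = [set p | ~ is_code U p.1 \/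
      (exists n, ~ is_code U (code_nth p.2 n)) \/
      exists a, bad_witness p.1 p.2 a]); last first.
    by apply/seteqP; split=> p /=; [move/contrapT|move=> h; exact].
  apply: Sigma11_or; last apply: Sigma11_or.
  - exact: (Sigma11_preimage (@fst_continuous baire baire) (@not_is_code_Sigma11 _ U)).
  - apply: Sigma11_existsn => n.
    have cf : continuous (fun p : baire * baire => code_nth p.2 n).
      by apply: continuous_comp2 (@code_nth_continuous n); exact: snd_continuous.
    exact: (Sigma11_preimage cf (@not_is_code_Sigma11 _ U)).
  - exact: (Sigma11_proj bad_witness_Sigma11).
apply/seteqP; split=> c.
  move=> [E hE [_ [F [eF fF iF EF]]]].
  have /choice[d hd] : forall n, exists d, borel_code U d (F n).
    by move=> n; apply/(borel_codeE _ bU); case: (eF n).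
  have hd' n : borel_code U (code_nth (pack d) n) (F n) by rewrite packK.
  exists (pack d) => /= -[|[[n]|[a /(bad_witnessP _ hE hd')]]].
  - by apply; exists E.
  - by apply; exists (F n).
  - case=> [|[[]|[nE [n Fn]]]].
    + by apply: (@not_bad_family _ setT) => // n; case: (eF n).
    + by rewrite EF => -[n _ Fn] /(_ n).
    + by apply: nE; rewrite EF; exists n.
move=> [d /= /not_orP[/contrapT[E hE] /not_orP[/forallNP h /forallNP nbad]]].
have {h}/choice[F hF] n : is_code U (code_nth d n) by apply: contrapT; exact: h.
have {}nbad p : ~ (bad_family F p \/ (E (p 0%N, p 1%N) /\
    forall n, ~ F n (p 0%N, p 1%N)) \/
    (~ E (p 0%N, p 1%N) /\ exists n, F n (p 0%N, p 1%N))).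
  have /choice[z hz] i := sg (p i).
  have pE : p = point (pack z) by apply/funext => i; rewrite /point packK.
  by rewrite pE => /(bad_witnessP _ hE hF); exact: nbad.
(* With the full relation as [Q], all families of points are tested. *)
have eqT : equivalence_on setT [set: X * X] by [].
have [|eF fF iF] := good_family eqT (F := F).
  by move=> p _ bad; apply: (nbad p); left.
have bF n : borel (F n) by apply/(borel_codeE _ bU); exists (code_nth d n).
have FT n : F n `&` setT = F n by rewrite setIT.
have EF : E = \bigcup_n F n.
  apply/seteqP; split=> [[x y] Exy|[x y] [n _ Fxy]]; apply: contrapT => nE.
    apply: (nbad (fun i => if i is 0%N then x else y)); right; left; split=> // n Fn.
    by apply: nE; exists n.
  by apply: (nbad (fun i => if i is 0%N then x else y)); right; right; split=> //; exists n.
exists E => //; rewrite EF; apply: hyperfinite_bigcup => n.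
- by split=> //; have := eF n; rewrite FT.
- by move=> x; have := fF n x; rewrite FT.
- by have := iF n; rewrite !FT.
Qed.

End upper_bound.

Lemma hyperfinite_codes_Sigma12 (R : realType) (X : topologicalType)
    (U : nat -> set (X * X)) :
  polish R X -> basis (range U) -> Sigma12 (hyperfinite_codes U).
Proof.
move=> pX bU; have [neX|eX] := pselect (exists _ : X, True); last first.
  exact: hyperfinite_codes_empty.
have [g cg sg] := polish_surjection pX neX.
exact: hyperfinite_codes_nonempty bU _ cg sg (polish_open_neq pX).
Qed.

(** * Infinite sets as points of the Baire space *)

(** The value of [g] at a positive position counts the numbers skipped between consecutive elements;
    this identifies the Baire space with [infsets], continuously in both directions. *)
Fixpoint gap_sum (g : baire) (n : nat) : nat :=
  if n is n'.+1 then (gap_sum g n' + g n).+1 else g 0%N.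

Lemma gap_sum_increasing g m n : (m < n)%N -> (gap_sum g m < gap_sum g n)%N.
Proof.
move: m n; apply: (homo_ltn ltn_trans) => n.
by rewrite /= ltnS leq_addr.
Qed.

Lemma gap_sum_ge g n : (g n <= gap_sum g n)%N.
Proof. by case: n => //= n; apply: leqW; rewrite leq_addl. Qed.

Lemma gap_sum_continuous : continuous (gap_sum : baire -> baire).
Proof.
apply/continuous_baireP; elim=> [|i IH] /=; first exact: lconst_coord.
exact: (lconst_comp2 (fun a b : nat => (a + b).+1) IH (@lconst_coord i.+1)).
Qed.

Definition of_gaps (g : baire) : infsets :=
  exist _ (gap_sum g : baire) (mem_set (@gap_sum_increasing g)).

Definition gaps (y : infsets) : baire := fun n =>
  if n is n'.+1 then (enumeration y n - (enumeration y n').+1)%N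
  else enumeration y 0.

Lemma enumeration_of_gaps g : enumeration (of_gaps g) = gap_sum g.
Proof. by []. Qed.

Lemma enumeration_inj : injective enumeration.
Proof. exact: val_inj. Qed.

Lemma enumeration_increasing y m n :
  (m < n)%N -> (enumeration y m < enumeration y n)%N.
Proof. by move: m n; case: y => x hx; exact: (set_mem hx). Qed.

Lemma gapsK : cancel gaps of_gaps.
Proof.
move=> y; apply: enumeration_inj; apply/funext => n.
rewrite enumeration_of_gaps; elim: n => //= n ->.
by rewrite -addSn subnKC //; exact: enumeration_increasing.
Qed.

Lemma of_gapsK : cancel of_gaps gaps.
Proof.
move=> g; apply/funext => -[|n] //.
by rewrite /gaps !enumeration_of_gaps /= -addSn addKn.
Qed.

Lemma of_gaps_continuous : continuous of_gaps.
Proof.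
move=> g A -[_ /= [[C oC <-] /= Cx CB]]; change (nbhs g (of_gaps @^-1` A)).
have : nbhs g (gap_sum @^-1` C).
  by apply: (gap_sum_continuous (x := g)); exact: open_nbhs_nbhs.
by apply: filterS => g' Cg'; exact: (CB (of_gaps g') Cg').
Qed.

Lemma enumeration_continuous : continuous (enumeration : infsets -> baire).
Proof. exact: initial_continuous. Qed.

Lemma gaps_continuous : continuous gaps.
Proof.
have := enumeration_continuous => /continuous_baireP ce.
apply/continuous_baireP => -[|i]; first exact: ce.
exact: (lconst_comp2 (fun a b : nat => (a - b.+1)%N)).
Qed.

(** * The Baire space is Polish *)

Lemma baire_second_countable : @second_countable baire.
Proof.
pose cyl (s : seq nat) : set baire := [set x | agree (size s) (nth 0%N s) x].
exists (range cyl); first exact: card_le_trans (card_image_le _ _) (countableP _).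
split=> [_ [s _ <-]|x A /nbhs_baireP[n nA]].
  apply: lconst_open; apply: (@lconst_determined baire Prop id
    (fun x => agree (size s) (nth 0%N s) x) (size s)).
    exact: id_continuous.
  move=> x y xy; apply/propext; split=> h; first exact: agree_trans h xy.
  exact: agree_trans h (agree_sym xy).
exists (cyl (mkseq x n)); last first.
  move=> y; rewrite /cyl /= size_mkseq => h; apply: nA => i im.
  by rewrite -h // nth_mkseq.
by split; [exists (mkseq x n)|rewrite /cyl /= size_mkseq => i ?; rewrite nth_mkseq].
Qed.

(** The distance is the ultrametric [1 / (k + 1)], where [k] is the first position of
    disagreement. *)
Lemma polish_baire (R : realType) : polish R baire.
Proof.
split; first exact: baire_second_countable.
pose inv (k : nat) : R := (k.+1%:R^-1)%R.
have inv_gt0 k : (0 < inv k)%R by rewrite invr_gt0 ltr0n.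
have inv_lt m n : (inv m < inv n)%R = (n < m)%N.
  by rewrite ltf_pV2 ?posrE ?ltr0n // ltr_nat.
have [d dP] : exists d : baire -> baire -> R, forall x y,
    (x = y /\ d x y = 0%R) \/
    (exists k, [/\ agree k x y, x k <> y k & d x y = inv k]).
  have /choice[d dP] : forall p : baire * baire, exists r : R,
      (p.1 = p.2 /\ r = 0%R) \/
      (exists k, [/\ agree k p.1 p.2, p.1 k <> p.2 k & r = inv k]).
    move=> [x y] /=; have [xy|xy] := pselect (x = y); first by exists 0%R; left.
    have ex : exists k, x k != y k.
      apply: contrapT => /forallNP h; apply: xy; apply/funext => k.
      by apply/eqP; apply: contrapT => /negP; exact: h.
    exists (inv (ex_minn ex)); right; exists (ex_minn ex); case: ex_minnP.
    move=> m /eqP hm hmin; split=> // i im; apply/eqP/negPn/negP => /hmin.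
    by rewrite leqNgt im.
  by exists (fun x y => d (x, y)) => x y; exact: (dP (x, y)).
have dlt x y n : (d x y < inv n)%R <-> agree n.+1 x y.
  case: (dP x y) => [[-> ->]|[k [a nk ->]]]; first by split.
  rewrite inv_lt; split=> [nk'|h]; first exact: agree_leq a.
  by rewrite ltnNge; apply/negP => kn; apply: nk; apply: h.
have dge x y k : x k <> y k -> (inv k <= d x y)%R.
  by move=> nk; rewrite leNgt; apply/negP => /dlt/(_ k (leqnn _)).
have dnn x y : (0 <= d x y)%R.
  by case: (dP x y) => [[_ ->//]|[k [_ _ ->]]]; rewrite ltW.
have small (e : R) : (0 < e)%R -> exists n, (inv n < e)%R.
  move=> e0; exists (Num.bound e^-1)%R.
  rewrite /inv -[ltRHS]invrK ltf_pV2 ?posrE ?invr_gt0 ?ltr0n //.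
  have : (e^-1 < (Num.bound e^-1)%:R)%R.
    by apply: archi_boundP; rewrite invr_ge0 ltW.
  by move=> /lt_trans; apply; rewrite ltr_nat.
exists d; split.
- move=> x y; split=> [|->]; last by case: (dP y y) => [[]|[k [_]]].
  case: (dP x y) => [[]|[k [_ _ -> E]]] //.
  by have := inv_gt0 k; rewrite E ltxx.
- have le x y : (d x y <= d y x)%R.
    case: (dP x y) => [[_ ->]|[k [_ nk ->]]] //.
    by apply: dge => E; apply: nk; rewrite E.
  by move=> x y; apply/eqP; rewrite eq_le !le.
- move=> x y z; case: (dP x z) => [[_ ->]|[k [_ nk ->]]].
    by rewrite addr_ge0.
  have [xy|xy] := pselect (x k = y k).
    have h : (inv k <= d y z)%R by apply: dge; rewrite -xy.
    by apply: le_trans h _; rewrite lerDr.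
  by apply: le_trans (dge _ _ _ xy) _; rewrite lerDl.
- move=> x A; split=> [/nbhs_baireP[n nA]|[e e0 eA]].
    exists (inv n) => // y /dlt h; apply: nA; exact: agree_leq h.
  have [n ne] := small e e0; apply/nbhs_baireP; exists n.+1 => y h.
  by apply: eA; apply: lt_trans ne; apply/dlt.
- move=> u cu.
  have /choice[N hN] : forall n, exists N, forall m m', (N <= m)%N ->
      (N <= m')%N -> agree n.+1 (u m) (u m').
    move=> n; have [N hN] := cu _ (inv_gt0 n).
    by exists N => m m' h h'; apply/dlt; exact: hN.
  exists (fun n => u (N n) n) => A /nbhs_baireP[n nA].
  suff [M hM] : exists M, forall m, (M <= m)%N -> agree n (fun n => u (N n) n) (u m).
    by exists M => // m /hM/nA.
  elim: n {nA} => [|n [M hM]]; first by exists 0%N.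
  exists (maxn M (N n)) => m; rewrite geq_max => /andP[/hM h Nm] i.
  rewrite ltnS leq_eqVlt => /predU1P[->|/h//].
  exact: (hN n).
Qed.

(** * Reduction to the Baire space *)

(** One clopen set is chosen for each pair of basic open sets that some clopen set separates. These
    countably many sets still separate points, and their indicators are the coordinates of [i]. *)
Lemma zero_dimensional_injection (V : topologicalType) :
  @second_countable V -> zero_dimensional V ->
  exists2 i : V -> baire, continuous i & injective i.
Proof.
move=> /second_countable_enum[O [_ hO]] zV.
have /choice[D hD] : forall p : nat * nat, exists D : set V, clopen D /\
    ((exists D', [/\ clopen D', O p.1 `<=` D' & O p.2 `<=` ~` D']) ->
     O p.1 `<=` D /\ O p.2 `<=` ~` D).
  move=> p; have [[D' [? ? ?]]|nD] := pselect (exists D',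
    [/\ clopen D', O p.1 `<=` D' & O p.2 `<=` ~` D']); first by exists D'.
  by exists set0; split=> //; split; [exact: open0|exact: closed0].
pose i (v : V) : baire := fun n =>
  nat_of_bool `[<D (odflt (0, 0)%N (unpickle n)) v>].
exists i.
  apply/continuous_baireP => n; rewrite /i.
  have [[oD cD] _] := hD (odflt (0, 0)%N (unpickle n)).
  apply: (lconst_comp nat_of_bool) => v; set P := D _ in oD cD *.
  have [Pv|nPv] := pselect (P v).
    have : nbhs v P by exact: open_nbhs_nbhs.
    by apply: filterS => w /= Pw; rewrite !asboolT.
  have : nbhs v (~` P) by apply: open_nbhs_nbhs; split=> //; rewrite openC.
  by apply: filterS => w /= Pw; rewrite !asboolF.
move=> x y E; apply: contrapT => /eqP/(zV x y)[P [[oP cP] Px nPy]].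
have [m [Omx OmP]] := hO x P (open_nbhs_nbhs (conj oP Px)).
have oP' : open (~` P) by rewrite openC.
have [n [Ony OnP]] := hO y (~` P) (open_nbhs_nbhs (conj oP' nPy)).
have [_ /(_ _)] := hD (m, n); case; first by exists P.
move=> h1 h2; have /= := congr1 (fun b : baire => b (pickle (m, n))) E.
by rewrite /i pickleK /= asboolT ?asboolF //; [exact: h2|exact: h1].
Qed.

Definition agree_closed3 (K : baire -> baire -> baire -> Prop) :=
  forall v z w, (forall n, exists v' z' w',
    [/\ agree n v v', agree n z z', agree n w w' & K v' z' w']) -> K v z w.

Lemma closed_agree3 (C : set (baire * baire * baire)) : closed C ->
  agree_closed3 (fun v z w => C ((v, z), w)).
Proof.
move=> cC v z w h; apply: cC => B.
move=> [[B1 B2] [/= [[B3 B4] [/= /nbhs_baireP[n1 h1] /nbhs_baireP[n2 h2]] h12]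
  /nbhs_baireP[n3 h3]] hB].
have [v' [z' [w' [a1 a2 a3 Cv]]]] := h (maxn n1 (maxn n2 n3)).
exists ((v', z'), w'); split=> //; apply: hB; split=> /=.
  apply: h12; split=> /=; first by apply: h1; apply: agree_leq a1; lia.
  by apply: h2; apply: agree_leq a2; lia.
by apply: h3; apply: agree_leq a3; lia.
Qed.

(** The image of [i] need not be closed. So the witness [w] also carries a preimage, under a
    continuous surjection [g] from the Baire space, of the point of [V]; that its image under [i] is
    the given point is a closed condition. *)
Lemma Sigma12_baire (R : realType) (V : topologicalType) (B : set V) :
  polish R V -> zero_dimensional V -> Sigma12 B -> (exists _ : V, True) ->
  exists2 i : V -> baire, continuous i & exists2 K, agree_closed3 K &
    forall v, B v <-> exists z, forall w, ~ K (i v) z w.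
Proof.
move=> pV zV [C [K cK CK] ->] neV.
have [i ci inji] := zero_dimensional_injection (proj1 pV) zV.
have [g cg sg] := polish_surjection pV neV.
exists i => //.
pose f (t : baire * baire * baire) := ((g (bsnd t.2), t.1.2), bfst t.2).
have cg2 : continuous (fun t : baire * baire * baire => g (bsnd t.2)).
  apply: continuous_comp2 cg; apply: continuous_comp2 bsnd_continuous.
  exact: snd_continuous.
have cf : continuous f.
  apply: continuous_pair; first apply: continuous_pair => //.
    exact: continuous_comp2 (@fst_continuous _ _) (@snd_continuous _ _).
  by apply: continuous_comp2 bfst_continuous; exact: snd_continuous.
pose C' := [set t : baire * baire * baire | (forall n, t.1.1 n = i (g (bsnd t.2)) n) /\ K (f t)].
have cC' : closed C'.
  apply: closedI; last exact: (proj1 (continuous_closedP f)).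
  apply: closed_forall => n; apply: lconst_closed; apply: (lconst_comp2 eq).
    move: n; apply/continuous_baireP.
    exact: continuous_comp2 (@fst_continuous _ _) (@fst_continuous _ _).
  by move: n; apply/continuous_baireP; exact: continuous_comp2 cg2 ci.
exists (fun v z w => C' ((v, z), w)); first exact: closed_agree3.
have CP v z : C (v, z) <-> forall w, ~ C' ((i v, z), w).
  have CK' : (~` C) (v, z) <-> exists w, K ((v, z), w) by rewrite CK.
  split=> [Cvz w [/= /funext/inji E Kw]|h].
    by apply: (proj2 CK') Cvz; exists (bfst w); rewrite E.
  apply: contrapT => /CK'[w Kw]; have [u hu] := sg v.
  by apply: (h (bpair w u)); rewrite /C' /f /= bsndK bfstK hu.
by move=> v; split=> -[z]; [move/CP|move=> /CP]; exists z.
Qed.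

(** * A self-referential closed set *)

(** [Phi] at [l] consults smaller indices only, so all iterates beyond the [l]-th agree at [l]. *)
Lemma guarded_fixpoint (P : Type) (Phi : (nat -> P) -> nat -> P) (p0 : P) :
  (forall K K' l, (forall n, (n < l)%N -> K n = K' n) -> Phi K l = Phi K' l) ->
  exists K, forall l, K l = Phi K l.
Proof.
move=> guard; pose it m := iter m Phi (fun=> p0).
have itE m m' l : (l < m)%N -> (l < m')%N -> it m l = it m' l.
  elim: m m' l => [//|m IH] [//|m'] l lm lm'; apply: guard => n nl.
  by apply: IH; lia.
exists (fun l => it l.+1 l) => l; apply: guard => n nl.
by apply: itE.
Qed.

Definition below (x y : baire) := forall n, (x n <= y n)%N.

(** The list coded by [j] overwrites an initial segment of [y]; domination by some [modify y j] is
    thus eventual domination by [y]. *)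
Definition modify (y : baire) (j : nat) : baire := fun n =>
  let s : seq nat := odflt [::] (unpickle j) in
  if (n < size s)%N then nth 0%N s n else y n.

Definition cut (n : nat) (x : baire) : baire :=
  fun i => if (i < n)%N then x i else 0%N.

Lemma agree_cut n x : agree n x (cut n x).
Proof. by move=> i ni; rewrite /cut ni. Qed.

(** The zeros beyond [n] are below anything, so only the first [n] values of the bound matter. *)
Lemma below_cut n x y y' : agree n y y' -> below x y -> below (cut n x) y'.
Proof. by move=> yy' xy i; rewrite /cut; case: ifP => // ni; rewrite -yy'. Qed.

Lemma agree_modify n y y' j : agree n y y' -> agree n (modify y j) (modify y' j).
Proof. by move=> h i ni; rewrite /modify; case: ifP => // _; exact: h. Qed.

Lemma agree_mkseq n (x : baire) : agree n x (nth 0%N (mkseq x n)).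
Proof. by move=> i ni; rewrite nth_mkseq. Qed.

(* C is the closed matrix of the Sigma12 set at hand; M e a says that a encodes
   a bad family for e, whose members are the fam a i, together with numbers
   nb a i j. *)
Section self_reference.
Variables (C : baire -> baire -> baire -> Prop) (M : baire -> baire -> Prop).
Variables (fam : baire -> nat -> baire) (nb : baire -> nat -> nat -> nat).
Hypothesis cC : agree_closed3 C.
Hypothesis cM : forall e a, (forall n, exists e' a',
  [/\ agree n e e', agree n a a' & M e' a']) -> M e a.
Hypothesis cfam : forall i, continuous (fam^~ i).
Hypothesis cnb : forall i j, lconst (fun a => nb a i j).

(** The tree [T_(v,z)]: as [C] is closed, its branches are the [w] with [C v z w]. *)
Definition in_tree (s : seq nat) (v z : baire) := exists v' z' w',
  [/\ agree (size s) v v', agree (size s) z z', agree (size s) (nth 0%N s) w'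
    & C v' z' w'].

(* A point x encodes z := bfst x and the length preserving monotone map of
   finite sequences with last values bsnd x. *)
Definition tree_map (x : baire) (s : seq nat) : seq nat :=
  mkseq (fun i => bsnd x (pickle (take i.+1 s))) (size s).

(** Level [k] of the tree of attempts. The number [nb a' i j] claims that at this stage of [K]
    nothing lies below the modification [j] of the member [i]. The claim is tested only at levels
    beyond that number, which guards the recursion. *)
Definition bad_step (K : nat -> baire -> baire -> baire -> Prop) (k : nat)
    (v e a : baire) := exists v' e' a',
  [/\ agree k v v', agree k e e', agree k a a', M e' a' &
      forall i j, (nb a' i j < k)%N ->
        ~ exists x, below x (modify (fam a' i) j) /\ K (nb a' i j) v' e' x].

Definition map_step (K : nat -> baire -> baire -> baire -> Prop) (l : nat)
    (v e x : baire) := exists v' e' x',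
  [/\ agree l v v', agree l e e', agree l x x' &
      forall s, (size s <= l)%N -> in_tree s v' (bfst x') ->
        bad_step K (size s) v' e' (nth 0%N (tree_map x' s))].

(** Stage [l] tests nodes of length at most [l], and [bad_step] at level [k] consults [K] below
    [k]. *)
Lemma map_step_guarded K K' l : (forall n, (n < l)%N -> K n = K' n) ->
  map_step K l = map_step K' l.
Proof.
move=> h; have bE k : (k <= l)%N -> bad_step K k = bad_step K' k.
  move=> kl; rewrite /bad_step; apply/funext => v; apply/funext => e.
  apply/funext => a; apply/propext.
  have hn n : (n < k)%N -> K n = K' n by move=> nk; apply: h; lia.
  by split=> -[v' [e' [a' [h1 h2 h3 h4 h5]]]]; exists v', e', a'; split=> // i j nk;
    have := h5 i j nk; rewrite hn.
apply/funext => v; apply/funext => e; apply/funext => x; apply/propext.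
by split=> -[v' [e' [x' [h1 h2 h3 h4]]]]; exists v', e', x'; split=> // s sl T;
  have := h4 s sl T; rewrite bE.
Qed.

Definition map_approx : nat -> baire -> baire -> baire -> Prop :=
  sval (cid (guarded_fixpoint (fun _ _ _ => True) map_step_guarded)).

Local Notation K := map_approx.

Lemma map_approxE l : K l = map_step K l.
Proof. exact: (svalP (cid (guarded_fixpoint _ map_step_guarded))). Qed.

(** [map_set v e] is the closed set [K_(v,e)], [bad_set v e] consists of the branches of the tree of
    attempts, and [S_v] is given by the negation of [sees]. *)
Definition map_set (v e x : baire) := forall l, K l v e x.
Definition bad_set (v e a : baire) := forall k, bad_step K k v e a.
Definition sees (v e y : baire) :=
  exists j x, below x (modify y j) /\ map_set v e x.

Lemma map_approx_agree l v v' e e' x x' :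
  agree l v v' -> agree l e e' -> agree l x x' -> K l v e x -> K l v' e' x'.
Proof.
move=> av ae ax; rewrite map_approxE => -[v1 [e1 [x1 [h1 h2 h3 h4]]]].
exists v1, e1, x1; split=> //.
- exact: agree_trans (agree_sym av) h1.
- exact: agree_trans (agree_sym ae) h2.
- exact: agree_trans (agree_sym ax) h3.
Qed.

Lemma bad_step_agree k v v' e e' a a' :
  agree k v v' -> agree k e e' -> agree k a a' ->
  bad_step K k v e a -> bad_step K k v' e' a'.
Proof.
move=> av ae ax [v1 [e1 [x1 [h1 h2 h3 h4 h5]]]].
exists v1, e1, x1; split=> //.
- exact: agree_trans (agree_sym av) h1.
- exact: agree_trans (agree_sym ae) h2.
- exact: agree_trans (agree_sym ax) h3.
Qed.

Lemma in_tree_agree s v v' z z' : agree (size s) v v' -> agree (size s) z z' ->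
  in_tree s v z -> in_tree s v' z'.
Proof.
move=> av az [v1 [z1 [w1 [h1 h2 h3 h4]]]]; exists v1, z1, w1; split=> //.
- exact: agree_trans (agree_sym av) h1.
- exact: agree_trans (agree_sym az) h2.
Qed.

Lemma in_tree_rcons s n v z : in_tree (rcons s n) v z -> in_tree s v z.
Proof.
move=> [v1 [z1 [w1]]]; rewrite size_rcons => -[h1 h2 h3 h4].
exists v1, z1, w1; split=> //; [exact: agree_leq h1|exact: agree_leq h2|].
move=> i si; rewrite -h3 ?nth_rcons ?si //; exact: ltnW.
Qed.

Lemma map_approx_leq m l v e x : (m <= l)%N -> K l v e x -> K m v e x.
Proof.
move=> ml; rewrite !map_approxE => -[v1 [e1 [x1 [h1 h2 h3 h4]]]].
exists v1, e1, x1; split; [exact: agree_leq h1|exact: agree_leq h2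
  |exact: agree_leq h3|].
by move=> s sm; apply: h4; exact: leq_trans ml.
Qed.

Lemma tree_map_lconst s : lconst (tree_map^~ s).
Proof.
rewrite /tree_map; move: (size s) => n; elim: n => [|n IH]; first exact: lconst_cst.
have -> : (fun x => mkseq (fun i => bsnd x (pickle (take i.+1 s))) n.+1) =
  (fun x => rcons (mkseq (fun i => bsnd x (pickle (take i.+1 s))) n)
     (bsnd x (pickle (take n.+1 s)))) by apply/funext => x; rewrite mkseqS.
apply: (lconst_comp2 rcons IH).
by move: (pickle _); apply/continuous_baireP; exact: bsnd_continuous.
Qed.

(** The map encoded by [x] reads finitely many values of [x] at [s], so a late enough stage has the
    same value there. *)
Lemma map_setP v e x : map_set v e x <-> forall s, in_tree s v (bfst x) ->
  bad_step K (size s) v e (nth 0%N (tree_map x s)).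
Proof.
split=> [h s Ts|h l]; last first.
  by rewrite map_approxE; exists v, e, x; split=> // s _; exact: h.
have /nbhs_baireP[n hn] := tree_map_lconst s x.
(* The doubling is there because [bfst] reads the even positions. *)
have := h (maxn n (size s).*2); rewrite map_approxE.
move=> [v' [e' [x' [av ae ax]]]].
have xx' : agree (size s) (bfst x) (bfst x').
  by move=> i si; apply: ax; lia.
have vv' : agree (size s) v v' by apply: agree_leq av; lia.
move=> /(_ s); rewrite hn; last by apply: agree_leq ax; lia.
move=> /(_ ltac:(lia) (in_tree_agree vv' xx' Ts)).
apply: bad_step_agree => //; first exact: agree_sym.
by apply: agree_sym; apply: agree_leq ae; lia.
Qed.

(** Compactness: the points below [y] branch finitely, and the stages [K n] decrease with [n]. *)
Lemma map_set_below v e y :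
  (forall n, exists x, below x y /\ K n v e x) ->
  exists x, below x y /\ map_set v e x.
Proof.
move=> h.
pose P s := forall n, exists x,
  [/\ agree (size s) (nth 0%N s) x, below x y & K n v e x].
have [|s Ps|u hu] := @dependent_choice_seq nat P.
- by move=> n; have [x [? ?]] := h n; exists x.
- apply: contrapT => /forallNP nP.
  have /choice[N hN] : forall a, exists n, ~ exists x,
      [/\ agree (size (rcons s a)) (nth 0%N (rcons s a)) x, below x y & K n v e x].
    by move=> a; apply: contrapT => /forallNP h'; apply: (nP a) => n;
       apply: contrapT; exact: h'.
  (* If each admissible next value [a] failed at some stage [N a], all would fail at the largest of
     these stages. *)
  have [x [sx xy Kx]] := Ps (\max_(a < (y (size s)).+1) N a).
  apply: (hN (x (size s))); exists x; split=> //.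
    move=> i; rewrite size_rcons ltnS leq_eqVlt nth_rcons => /predU1P[->|il].
      by rewrite ltnn eqxx.
    by rewrite il sx.
  apply: map_approx_leq Kx.
  have lt : (x (size s) < (y (size s)).+1)%N by rewrite ltnS.
  exact: (leq_bigmax (F := fun a : 'I_ _ => N a) (Ordinal lt)).
- exists u; split=> [n|l].
    have [x [ax xy _]] := hu n.+1 0%N.
    have <- : x n = u n by rewrite -ax ?size_mkseq // nth_mkseq.
    exact: xy.
  have [x [ax xy Kx]] := hu l l.
  apply: map_approx_agree Kx => //; rewrite size_mkseq in ax.
  by apply: agree_trans (agree_sym ax) _; apply: agree_sym; exact: agree_mkseq.
Qed.

Lemma seesP v e y : sees v e y <->
  exists j, forall n, exists x, below x (modify y j) /\ K n v e x.
Proof.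
split=> [[j [x [xy Kx]]]|[j /map_set_below[x]]]; last by exists j, x.
by exists j => n; exists x.
Qed.

(** By compactness the quantifier over [x] can be moved inside each stage [n], where it ranges over
    [cut n x] and reads finitely many values. *)
Lemma sees_borel (T : topologicalType) (v e y : T -> baire) :
  continuous v -> continuous e -> continuous y ->
  borel [set t | sees (v t) (e t) (y t)].
Proof.
move=> /continuous_baireP cv /continuous_baireP ce /continuous_baireP cy.
have -> : [set t | sees (v t) (e t) (y t)] = [set t |
    exists j, forall n, exists x, below x (modify (y t) j) /\ K n (v t) (e t) x].
  by apply/seteqP; split=> t /seesP.
apply: borel_existsn => j; apply: borel_forall => n; apply: lconst_borel => t.
apply: filterS (filterI (lconst_agree cv n t)
  (filterI (lconst_agree ce n t) (lconst_agree cy n t))) => u /= [av [ae ay]].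
apply/propext; split=> -[x [xy Kx]]; exists (cut n x); split.
- by apply: below_cut xy; apply: agree_modify; exact: agree_sym.
- by apply: map_approx_agree Kx; [exact: agree_sym..|exact: agree_cut].
- by apply: below_cut xy; exact: agree_modify.
- by apply: map_approx_agree Kx; [..|exact: agree_cut].
Qed.

(** An element of [map_set] below a modification of a member would also be found at stage
    [nb a i j], against the claim tested at a later level. *)
Lemma bad_set_sound v e a :
  bad_set v e a -> M e a /\ forall i, ~ sees v e (fam a i).
Proof.
move=> h; split.
  apply: cM => n; have [v' [e' [a' [_ ae aa Ma _]]]] := h n.
  by exists e', a'.
move=> i [j [x [xy Kx]]]; pose n := nb a i j.
have /nbhs_baireP[k1 hk1] := cnb i j a.
have /nbhs_baireP[k2 hk2] : nbhs a [set a' | agree n (fam a i) (fam a' i)].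
  by apply: lconst_agree; apply/continuous_baireP; exact: cfam.
have [v' [e' [a' [av ae aa _]]]] := h (maxn n.+1 (maxn k1 k2)).
have nE : nb a' i j = n by apply: hk1; apply: agree_leq aa; lia.
move=> /(_ i j); rewrite nE => /(_ ltac:(lia)); apply.
exists (cut n x); split.
  apply: below_cut xy; apply: agree_modify; apply: hk2.
  by apply: agree_leq aa; lia.
apply: map_approx_agree (Kx n); last exact: agree_cut.
  by apply: agree_leq av; lia.
by apply: agree_leq ae; lia.
Qed.

Lemma bad_set_complete v e a : M e a ->
  (forall i j, ~ exists x, below x (modify (fam a i) j) /\ K (nb a i j) v e x) ->
  bad_set v e a.
Proof. by move=> Ma h k; exists v, e, a. Qed.

(** The map encoded by [x] preserves length and order, so it sends the branch [w] to a branch. *)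
Lemma map_set_path v e x w : map_set v e x -> C v (bfst x) w ->
  exists a, bad_set v e a.
Proof.
move=> /map_setP h Cw; pose a : baire := fun k => bsnd x (pickle (mkseq w k.+1)).
exists a => k; have := h (mkseq w k).
rewrite size_mkseq => /(_ _)/wrap[].
  exists v, (bfst x), w; split=> //; rewrite size_mkseq.
  apply: agree_sym; exact: agree_mkseq.
have -> : tree_map x (mkseq w k) = mkseq a k.
  rewrite /tree_map size_mkseq; apply/eq_in_map => i.
  rewrite mem_iota add0n => /andP[_ ik]; rewrite /a; congr (bsnd x (pickle _)).
  rewrite /mkseq -map_take take_iota; congr map; congr iota; lia.
by apply: bad_step_agree => //; apply: agree_sym; exact: agree_mkseq.
Qed.

(** * The game over a well-founded tree *)

Section witness.
Variables (v z0 : baire).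
Hypothesis z0P : forall w, ~ C v z0 w.

Local Notation T s := (in_tree s v z0).

Inductive wf_node : seq nat -> Prop :=
| Wf_node s : (forall n, T (rcons s n) -> wf_node (rcons s n)) -> wf_node s.

(** An infinite path of nodes would, by closedness of [C], be a [w] with [C v z0 w]. *)
Lemma wf_node_tree s : T s -> wf_node s.
Proof.
elim/last_ind: s => [_|s n IH Tn]; last first.
  have wf := IH (in_tree_rcons Tn).
  by case: wf Tn => s' h Tn; exact: h.
apply: contrapT => nwf.
have [|s [Ts ns]|w hw] := @dependent_choice_seq nat
    (fun s => (s = [::] \/ T s) /\ ~ wf_node s).
- by split=> //; left.
- apply: contrapT => /forallNP h; apply: ns; constructor => n Tn.
  by apply: contrapT => nn; apply: (h n); split=> //; right.
- apply: (z0P (w := w)); apply: cC => n.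
  have [[E|Tn] _] := hw n.+1.
    by move/(congr1 size): E; rewrite size_mkseq.
  move: Tn => [v1 [z1 [w1]]]; rewrite size_mkseq => -[h1 h2 h3 h4].
  exists v1, z1, w1; split=> //; [exact: agree_leq h1|exact: agree_leq h2|].
  apply: agree_leq (leqnSn n) _; apply: agree_trans h3; exact: agree_mkseq.
Qed.

(* The second player loses from (s, t) when no length preserving monotone map
   of the tree at s into the tree of bad families sends s to t. *)
Inductive lose (e : baire) : seq nat -> seq nat -> Prop :=
| Lose_now s t : ~ bad_step K (size s) v e (nth 0%N t) -> lose e s t
| Lose_later s t n : T (rcons s n) ->
    (forall m, lose e (rcons s n) (rcons t m)) -> lose e s t.

(** Answering every move with the next value of an element of [bad_set] would never lose. *)
Lemma lose_bad_set e : lose e [::] [::] -> forall a, ~ bad_set v e a.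
Proof.
move=> le a ba.
suff h s t : lose e s t -> t <> mkseq a (size s) by exact: h le erefl.
elim=> {}s {}t => [nbs E|n _ _ IH E].
  apply: nbs; rewrite E; apply: bad_step_agree (ba (size s)) => //.
  exact: agree_mkseq.
by apply: (IH (a (size s))); rewrite size_rcons mkseqS -E.
Qed.

(** Recursion on the well-founded tree: each level adds countable operations, and [bad_step] reads
    only [size s] values of [e]. *)
Lemma lose_borel s t : wf_node s -> borel [set e | lose e s t].
Proof.
move=> wf; elim: wf t => {}s _ IH t.
have -> : [set e | lose e s t] = [set e | ~ bad_step K (size s) v e (nth 0%N t) \/
    exists n, T (rcons s n) /\ forall m, T (rcons s n) -> lose e (rcons s n) (rcons t m)].
  apply/seteqP; split=> e.
    by case=> [s' t' ?|s' t' n Tn h]; [left|right; exists n].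
  by case=> [|[n [Tn h]]]; [exact: Lose_now|apply: (Lose_later Tn) => m; exact: h].
apply: borel_or.
  apply: lconst_borel; apply: (lconst_comp not).
  apply: (@lconst_determined baire Prop id
    (fun e => bad_step K (size s) v e (nth 0%N t)) (size s)).
    exact: id_continuous.
  move=> x y xy; apply/propext; split; apply: bad_step_agree => //.
  exact: agree_sym.
apply: borel_existsn => n; apply: borel_and; first exact: lconst_borel (lconst_cst _).
by apply: borel_forall => m; apply: borel_impl => Tn; exact: IH.
Qed.

(** Taking the least answer that does not lose makes the choice Borel in [e]. *)
Definition reply (e : baire) (s t : seq nat) : nat :=
  if pselect (exists m, `[< ~ lose e s (rcons t m) >]) is left h then ex_minn h
  else 0%N.

(** The fold carries the moves read so far together with the answers given. *)
Definition replies (e : baire) (s : seq nat) : seq nat :=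
  (foldl (fun p n => (rcons p.1 n, rcons p.2 (reply e (rcons p.1 n) p.2)))
    ([::], [::]) s).2.

Lemma replies_rcons e s n :
  replies e (rcons s n) = rcons (replies e s) (reply e (rcons s n) (replies e s)).
Proof.
rewrite /replies foldl_rcons /=; set p := foldl _ _ _.
suff -> : p.1 = s by [].
by rewrite /p; elim/last_ind: s {p} => // s m IH; rewrite foldl_rcons /= IH.
Qed.

Lemma replies_winning e s : ~ lose e [::] [::] -> T s -> ~ lose e s (replies e s).
Proof.
move=> nl; elim/last_ind: s => // s n IH Tn.
have {}IH := IH (in_tree_rcons Tn); rewrite replies_rcons /reply.
case: pselect => [h|nh]; first by case: ex_minnP => m /asboolP.
move=> _; apply: IH; apply: (Lose_later Tn) => m; apply: contrapT => nm.
by apply: nh; exists m; exact/asboolP.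
Qed.

Lemma reply_borel s t m : T s -> borel [set e | reply e s t = m].
Proof.
move=> Ts; have bl t' := lose_borel t' (wf_node_tree Ts).
have -> : [set e | reply e s t = m] = [set e |
   (~ lose e s (rcons t m) /\ forall m', (m' < m)%N -> lose e s (rcons t m')) \/
   (m = 0%N /\ forall m', lose e s (rcons t m'))].
  apply/seteqP; split=> e /=; rewrite /reply.
    case: pselect => [h|nh].
      case: ex_minnP => k /asboolP nk hk <-; left; split=> // m' m'k.
      apply: contrapT => nm; have := hk m'; rewrite leqNgt m'k => /(_ _)/wrap[] //.
      exact/asboolP.
    move=> <-; right; split=> // m'; apply: contrapT => nm; apply: nh.
    by exists m'; exact/asboolP.
  case=> [[nm hm]|[-> hm]]; case: pselect => [h|nh] //.
  - case: ex_minnP => k /asboolP nk hk; apply/eqP; rewrite eqn_leq.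
    rewrite hk /=; last exact/asboolP.
    by rewrite leqNgt; apply/negP => /hm.
  - by case: nh; exists m; exact/asboolP.
  - by case: ex_minnP => k /asboolP nk; case: nk.
apply: borel_or; apply: borel_and.
- by apply: borel_not; exact: bl.
- by apply: borel_forall => m'; apply: borel_impl => _; exact: bl.
- exact: lconst_borel (lconst_cst _).
- by apply: borel_forall => m'; exact: bl.
Qed.

Lemma replies_borel s t : T s -> borel [set e | replies e s = t].
Proof.
elim/last_ind: s t => [t _|s n IH t Tn].
  exact: (lconst_borel (lconst_cst ([::] = t))).
have Ts := in_tree_rcons Tn.
have -> : [set e | replies e (rcons s n) = t] =
    [set e | (t <> [::] /\ replies e s = belast (head 0%N t) (behead t)) /\
       reply e (rcons s n) (belast (head 0%N t) (behead t)) = last 0%N t].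
  apply/seteqP; split=> e /=; rewrite replies_rcons.
    move=> <-; set r := replies e s; set m := reply _ _ _.
    have E : belast (head 0%N (rcons r m)) (behead (rcons r m)) = r.
      by case: (r) => //= a r'; rewrite belast_rcons.
    by rewrite E last_rcons; split=> //; split=> //; case: (r).
  move=> [[t0 ->] ->]; case: t t0 => //= a t _.
  by rewrite -lastI.
apply: borel_and; last exact: reply_borel.
apply: borel_and; first exact: lconst_borel (lconst_cst _).
exact: IH.
Qed.

Definition winning_map (e : baire) : baire :=
  bpair z0 (fun i => let s : seq nat := odflt [::] (unpickle i) in
    if pselect (T s) then last 0%N (replies e s) else 0%N).

Lemma winning_map_borel i m : borel [set e | winning_map e i = m].
Proof.
rewrite /winning_map /bpair; case: (odd i); last exact: lconst_borel (lconst_cst _).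
move: (odflt _ _) => s; case: pselect => /= [Ts|_]; last first.
  exact: lconst_borel (lconst_cst _).
have -> : (fun e => last 0%N (replies e s) = m) = [set e | exists n : nat,
    let t : seq nat := odflt [::] (unpickle n) in
    replies e s = t /\ last 0%N t = m].
  apply/seteqP; split=> [e E|e [n [-> //]]].
  by exists (pickle (replies e s)); rewrite pickleK.
apply: borel_existsn => n; apply: borel_and; first exact: replies_borel.
exact: lconst_borel (lconst_cst _).
Qed.

Lemma winning_map_set e : ~ lose e [::] [::] -> map_set v e (winning_map e).
Proof.
move=> nl; apply/map_setP => s; rewrite /winning_map bfstK => Ts.
have -> : tree_map (winning_map e) s = replies e s.
  rewrite /tree_map /winning_map bsndK; elim/last_ind: s Ts => // s n IH Tn.
  rewrite size_rcons mkseqS replies_rcons; congr rcons.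
    rewrite -IH; last exact: in_tree_rcons Tn.
    apply/eq_in_map => i; rewrite mem_iota add0n => /andP[_ ik].
    by rewrite -cats1 takel_cat.
  rewrite -(size_rcons s n) take_size pickleK /=; case: pselect => //= _.
  by rewrite replies_rcons last_rcons.
by apply: contrapT => nbs; apply: (replies_winning nl Ts); exact: Lose_now.
Qed.

End witness.
End self_reference.

(** * The lower bound *)

Lemma equivalence_glue (T : topologicalType) (D1 D2 : set T)
    (G1 G2 : set (T * T)) :
  equivalence_on D1 G1 -> equivalence_on D2 G2 -> (forall x, D1 x -> ~ D2 x) ->
  equivalence_on setT [set p | p.1 = p.2 \/ (G1 p \/ G2 p)].
Proof.
move=> [s1 r1 y1 t1] [s2 r2 y2 t2] dis; split=> //.
- by move=> x _; left.
- by move=> x y [/= ->|[/y1|/y2]]; [left|right; left|right; right].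
- move=> x y z [/= -> //|[h|h]] [/= <-|[h'|h']].
  + by right; left.
  + by right; left; exact: t1 h h'.
  + by case: (dis y); [case: (s1 _ h)|case: (s2 _ h')].
  + by right; right.
  + by case: (dis y); [case: (s1 _ h')|case: (s2 _ h)].
  + by right; right; exact: t2 h h'.
Qed.

Lemma le_inftyPn (y x : infsets) : ~ le_infty y x ->
  exists N, forall n, (N <= n)%N -> (enumeration x n < enumeration y n)%N.
Proof.
move=> /contrapT/finite_seqP[s E]; exists (\max_(i <- s) i).+1 => n Nn.
rewrite ltnNge; apply/negP => h.
have : [set n | (enumeration y n <= enumeration x n)%N] n by [].
rewrite E /= => ns.
have le : (n <= \max_(i <- s) i)%N by exact: leq_bigmax_seq.
by move: Nn; rewrite ltnNge le.
Qed.

Section lower_bound.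
Variables (E : set (infsets * infsets)) (U : nat -> set (baire * baire)).
Let D : set (infsets * infsets) := [set p | le_infty p.2 p.1].
Hypothesis cberE : cber_on setT E.
Hypothesis bU : basis (range U).

Let oU n : open (U n). Proof. by case: bU => h _; apply: h; exists n. Qed.

Let E_refl y : E (y, y). Proof. by case: cberE => -[[_ h _ _] _] _; exact: h. Qed.
Let E_sym x y : E (x, y) -> E (y, x).
Proof. by case: cberE => -[[_ _ h _] _] _; exact: h. Qed.
Let E_trans x y z : E (x, y) -> E (y, z) -> E (x, z).
Proof. by case: cberE => -[[_ _ _ h] _] _; exact: h. Qed.

(* A point x of the Baire space stands for the pair of the code bfst x of a
   sequence of Borel relations and of the infinite set with gaps bsnd x. *)
Let set_of (x : baire) := of_gaps (bsnd x).
Let unpair (b : baire) := (bfst b, bsnd b).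
Let member (e c : baire) i := bpair e (code_nth c i).

Let unpair_continuous : continuous unpair.
Proof.
by apply: continuous_pair; [exact: bfst_continuous|exact: bsnd_continuous].
Qed.

Let set_of_continuous : continuous set_of.
Proof. exact: continuous_comp2 bsnd_continuous of_gaps_continuous. Qed.

Let E_borel (T : topologicalType) (f g : T -> baire) :
  continuous f -> continuous g -> borel [set t | E (set_of (f t), set_of (g t))].
Proof.
move=> cf cg; have bE : borel E by case: cberE => -[].
apply: (borel_preimage (f := fun t => (set_of (f t), set_of (g t)))) bE.
by apply: continuous_pair; apply: continuous_comp2 set_of_continuous.
Qed.

Definition bad_for (e c : baire) :=
  (forall i j, E (set_of (member e c i), set_of (member e c j))) /\
  ((exists n, ~ is_code U (code_nth e n)) \/
   (bad_pattern
      (fun n i j => evaluates U 1 (code_nth e n) (member e c i, member e c j))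
      (fun n i j => evaluates U 0 (code_nth e n) (member e c i, member e c j))
      (fun i j => member e c i <> member e c j) \/
    exists i j, forall n,
      evaluates U 0 (code_nth e n) (member e c i, member e c j))).

Lemma neq_Sigma11 (T : topologicalType) (f g : T -> baire) :
  continuous f -> continuous g -> Sigma11 [set t | f t <> g t].
Proof.
move=> /continuous_baireP cf /continuous_baireP cg.
have -> : [set t | f t <> g t] = [set t | exists k, f t k <> g t k].
  apply/seteqP; split=> [t fg|t [k h] fg]; last by rewrite fg in h.
  apply: contrapT => /forallNP h; apply: fg; apply/funext => k.
  by apply: contrapT; exact: h.
apply: Sigma11_existsn => k; apply: lconst_Sigma11.
exact: (lconst_comp2 (fun a b : nat => a <> b)).
Qed.

Lemma bad_for_Sigma11 : Sigma11 [set p : baire * baire | bad_for p.1 p.2].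
Proof.
pose m i (p : baire * baire) := member p.1 p.2 i.
have cm i : continuous (m i).
  apply: bpair_continuous; first exact: fst_continuous.
  by apply: continuous_comp2 (@code_nth_continuous i); exact: snd_continuous.
have cn n : continuous (fun p : baire * baire => code_nth p.1 n).
  by apply: continuous_comp2 (@code_nth_continuous n); exact: fst_continuous.
pose r i j (p : baire * baire) := bpair (m i p) (m j p).
have cr i j : continuous (r i j) by exact: bpair_continuous.
have ev b n i j : Sigma11 [set p : baire * baire |
    evaluates U b (code_nth p.1 n) (member p.1 p.2 i, member p.1 p.2 j)].
  have -> : [set p : baire * baire |
      evaluates U b (code_nth p.1 n) (member p.1 p.2 i, member p.1 p.2 j)] =
    [set p | evaluates U b (code_nth p.1 n) (unpair (r i j p))].
    by apply/seteqP; split=> p /=; rewrite /unpair /r bfstK bsndK.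
  exact: evaluates_Sigma11.
apply: Sigma11_and.
  apply: Sigma11_forall => i; apply: Sigma11_forall => j.
  have -> : (fun p : baire * baire => E (set_of (member p.1 p.2 i),
        set_of (member p.1 p.2 j))) =
      r i j @^-1` [set b | E (set_of (bfst b), set_of (bsnd b))].
    by apply/seteqP; split=> p /=; rewrite /r bfstK bsndK.
  apply: Sigma11_preimage => //; apply: borel_Sigma11; apply: E_borel.
    exact: bfst_continuous.
  exact: bsnd_continuous.
apply: Sigma11_or; last apply: Sigma11_or.
- apply: Sigma11_existsn => n.
  exact: (Sigma11_preimage (cn n) (@not_is_code_Sigma11 _ U)).
- by apply: bad_pattern_Sigma11 => [n i j|n i j|i j]; [exact: ev|exact: ev|];
     exact: (neq_Sigma11 (cm i) (cm j)).
- apply: Sigma11_existsn => i; apply: Sigma11_existsn => j.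
  by apply: Sigma11_forall => n; exact: ev.
Qed.

Lemma bad_forP e c (F : nat -> set (baire * baire)) :
  (forall n, borel_code U (code_nth e n) (F n)) -> bad_for e c <->
  (forall i j, E (set_of (member e c i), set_of (member e c j))) /\
  (bad_family F (member e c) \/
   exists i j, forall n, ~ F n (member e c i, member e c j)).
Proof.
move=> hF; have e1 n w := evaluates1P w (hF n); have e0 n w := evaluates0P w (hF n).
rewrite /bad_for /bad_family (@bad_pattern_equiv _
  (fun n i j => F n (member e c i, member e c j)) _
  (fun n i j => ~ F n (member e c i, member e c j))) //.
split=> -[hE h]; split=> //.
  case: h => [[n []]|[|[i [j h]]]]; [by exists (F n)|by left|right].
  by exists i, j => n; apply/e0.
case: h => [|[i [j h]]]; [by right; left|right; right].
by exists i, j => n; apply/e0.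
Qed.

Variable C : baire -> baire -> baire -> Prop.
Hypothesis cC : agree_closed3 C.

Variable evidence : set (baire * baire * baire).
Hypothesis closed_evidence : closed evidence.
Hypothesis evidenceP : forall e c, bad_for e c <-> exists w, evidence ((e, c), w).

(** A point [a] packs a family, the numbers [nb] and evidence that the family is bad for [e]. *)
Let M (e a : baire) := evidence ((e, bfst a), bsnd (bsnd a)).
Let fam (a : baire) i : baire := gap_sum (code_nth (bfst a) i).
Let nb (a : baire) i j := code_nth (bfst (bsnd a)) i j.

Let cM e a : (forall n, exists e' a',
  [/\ agree n e e', agree n a a' & M e' a']) -> M e a.
Proof.
move=> h; apply: (closed_agree3 closed_evidence) => n.
(* Position [i] of [bsnd (bsnd a)] is position [4 * i + 3] of [a]. *)
have [e' [a' [ae aa Ma]]] := h (4 * n).+4%N.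
exists e', (bfst a'), (bsnd (bsnd a')); split=> //.
- by apply: agree_leq ae; lia.
- by move=> i ni; apply: aa; lia.
- by move=> i ni; apply: aa; lia.
Qed.

Let cfam i : continuous (fam^~ i).
Proof.
apply: continuous_comp2 gap_sum_continuous.
exact: continuous_comp2 bfst_continuous (@code_nth_continuous i).
Qed.

Let cnb i j : lconst (fun a => nb a i j).
Proof.
have c : continuous (fun a => code_nth (bfst (bsnd a)) i).
  apply: continuous_comp2 (@code_nth_continuous i).
  exact: continuous_comp2 bsnd_continuous bfst_continuous.
by move/continuous_baireP: c; exact.
Qed.

Local Notation sees := (sees C M fam nb).
Local Notation bad_set := (bad_set C M fam nb).

Let S (v x : baire) := ~ sees v (bfst x) (gap_sum (bsnd x)).

(** The diagonal is added to obtain an equivalence relation on the whole space. *)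
Definition coded_relation (v : baire) : set (baire * baire) :=
  [set p | p.1 = p.2 \/ (bfst p.1 = bfst p.2 /\
    (E (set_of p.1, set_of p.2) /\ (S v p.1 /\ S v p.2)))].

Let S_borel (T : topologicalType) (v x : T -> baire) :
  continuous v -> continuous x -> borel [set t | S (v t) (x t)].
Proof.
move=> cv cx; apply: borel_not; apply: sees_borel => //.
  exact: continuous_comp2 cx bfst_continuous.
apply: continuous_comp2 gap_sum_continuous.
exact: continuous_comp2 cx bsnd_continuous.
Qed.

Lemma eq_borel (T : topologicalType) (f g : T -> baire) :
  continuous f -> continuous g -> borel [set t | f t = g t].
Proof.
move=> /continuous_baireP cf /continuous_baireP cg.
have -> : [set t | f t = g t] = [set t | forall k, f t k = g t k].
  by apply/seteqP; split=> [t /= ->//|t /= h]; exact/funext.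
apply: borel_forall => k; apply: lconst_borel.
exact: (lconst_comp2 (fun a b : nat => a = b)).
Qed.

Lemma coded_relation_borel :
  borel [set t : baire * (baire * baire) | coded_relation t.1 t.2].
Proof.
have c1 : continuous (fun t : baire * (baire * baire) => t.2.1).
  exact: continuous_comp2 (@snd_continuous _ _) (@fst_continuous _ _).
have c2 : continuous (fun t : baire * (baire * baire) => t.2.2).
  exact: continuous_comp2 (@snd_continuous _ _) (@snd_continuous _ _).
have c0 : continuous (fun t : baire * (baire * baire) => t.1).
  exact: fst_continuous.
apply: borel_or; first exact: eq_borel.
apply: borel_and.
  by apply: eq_borel; apply: continuous_comp2 bfst_continuous.
apply: borel_and; first exact: E_borel.
by apply: borel_and; exact: S_borel.
Qed.

Let bad_set_bad_for v e a : bad_set v e a ->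
  bad_for e (bfst a) /\ forall i, S v (member e (bfst a) i).
Proof.
move=> /(bad_set_sound cM cfam cnb)[Ma h]; split.
  by apply/evidenceP; exists (bsnd (bsnd a)).
by move=> i; rewrite /S /member bfstK bsndK; exact: h.
Qed.

(** By [seesP], each modification of each member has a stage of [K] with nothing below it; these
    stages are the numbers [nb]. *)
Let bad_for_bad_set v e c : bad_for e c -> (forall i, S v (member e c i)) ->
  exists a, bad_set v e a.
Proof.
move=> /evidenceP[w hw] hS.
have /choice[n hn] : forall p : nat * nat, exists n, ~ exists x,
    below x (modify (gap_sum (code_nth c p.1)) p.2) /\
    map_approx C M fam nb n v e x.
  move=> [i j]; apply: contrapT => /forallNP h; apply: (hS i).
  rewrite /S /member bfstK bsndK; apply/seesP; exists j => n.
  by apply: contrapT; exact: h.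
exists (bpair c (bpair (pack (fun i j => n (i, j))) w)).
apply: bad_set_complete; first by rewrite /M bfstK !bsndK.
move=> i j; rewrite /fam /nb bfstK bsndK bfstK packK.
exact: (hn (i, j)).
Qed.

Lemma coded_relation_not_hyperfinite v : ~ hyperfinite_on setT E ->
  (forall z, exists w, C v z w) -> ~ hyperfinite_on setT (coded_relation v).
Proof.
move=> nhE hC [_ [F [eF fF iF RF]]].
have /choice[d hd] : forall n, exists d, borel_code U d (F n).
  by move=> n; apply/(borel_codeE _ bU); case: (eF n).
(* Diagonalization: [e] codes the alleged witness itself, which is then refuted in the fibre over
   [e]. *)
pose e := pack d.
have he n : borel_code U (code_nth e n) (F n) by rewrite packK.
(* Otherwise the traces of the [F n] on the fibre over [e] would show that [E] is hyperfinite. *)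
have [g [g' [Egg nF]]] : exists g g', E (of_gaps g, of_gaps g') /\
    forall n, ~ F n (bpair e g, bpair e g').
  apply: contrapT => nE; apply: nhE.
  pose m (p : infsets * infsets) := (bpair e (gaps p.1), bpair e (gaps p.2)).
  have cm : continuous m.
    by apply: continuous_pair; apply: bpair_continuous;
       [exact: cst_continuous|apply: continuous_comp2 gaps_continuous;
        exact: fst_continuous|exact: cst_continuous|
        apply: continuous_comp2 gaps_continuous; exact: snd_continuous].
  have -> : E = \bigcup_n (m @^-1` F n).
    apply/seteqP; split=> [[x y] Exy|[x y] [n _ Fxy]].
      apply: contrapT => nF; apply: nE; exists (gaps x), (gaps y).
      by rewrite !gapsK; split=> // n Fn; apply: nF; exists n.
    have : coded_relation v (m (x, y)) by rewrite RF; exists n.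
    case=> /= [/(congr1 bsnd)|[_ [+ _]]].
      by rewrite !bsndK => /(can_inj gapsK) ->.
    by rewrite /set_of !bsndK !gapsK.
  apply: hyperfinite_bigcup.
  - move=> n; have [[_ r s t] bF] := eF n; split; last exact: borel_preimage.
    split=> // [x _|x y|x y z]; [exact: r|exact: s|exact: t].
  - move=> n x; apply: (@finite_preimage _ _ [set w | F n (bpair e (gaps x), w)]
      (fun y => bpair e (gaps y))); last exact: fF.
    by move=> y y' _ _ /(congr1 bsnd); rewrite !bsndK => /(can_inj gapsK).
  - by move=> n p; exact: iF.
pose c := pack (fun i => if i == 0%N then g else g').
have bad : bad_for e c.
  apply/(bad_forP _ he); split; last first.
    by right; exists 0%N, 1%N => n; rewrite /member !packK; exact: nF.
  move=> i j; rewrite /set_of /member !bsndK !packK.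
  by case: eqP => _; case: eqP => _ //; exact: E_sym.
have [a ba] : exists a, bad_set v e a.
  (* If some member sees an element [x] of [map_set], the tree of [v] and [bfst x] has a branch by
     [hC], and [x] maps it to an element of [bad_set]. *)
  have [|nS] := pselect (forall i, S v (member e c i)); first exact: bad_for_bad_set.
  have [i /contrapT] := (proj2 (existsNP _)) nS.
  move=> [j [x [_ Kx]]]; rewrite /member bfstK in Kx.
  by have [w Cw] := hC (bfst x); exact: map_set_path Kx Cw.
have [/(bad_forP _ he)[hE hbad] hS] := bad_set_bad_for ba.
case: hbad => [|[i [j nij]]].
  by apply: (@not_bad_family _ setT) => // n; case: (eF n).
have : coded_relation v (member e (bfst a) i, member e (bfst a) j).
  right; split; first by rewrite /member /= !bfstK.
  by split; [exact: hE|split; exact: hS].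
by rewrite RF => -[n _]; exact: nij.
Qed.

(** * Hyperfiniteness when some tree has no branch *)

Section hyperfinite_case.
Variables (v z0 : baire).
Hypothesis z0P : forall w, ~ C v z0 w.

(** For [e] in [lo] no bad family lies in [S v]; for the others a winning map exists. *)
Let lo e := lose C M fam nb v z0 e [::] [::].

Let lo_borel : borel lo.
Proof.
have [T0|nT0] := pselect (in_tree C [::] v z0).
  exact: (lose_borel M fam nb [::] (wf_node_tree cC z0P T0)).
(* If the tree is empty, the root is well-founded for lack of children. *)
apply: (lose_borel M fam nb [::] (s := [::])); constructor => n Tn.
by case: nT0; exact: in_tree_rcons Tn.
Qed.

Let Q : set (baire * baire) := [set p | lo (bfst p.1) /\ (bfst p.1 = bfst p.2 /\
  (E (set_of p.1, set_of p.2) /\ (S v p.1 /\ S v p.2)))].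
Let DQ : set baire := [set x | lo (bfst x) /\ S v x].
Let F n : set (baire * baire) :=
  [set p | evaluates U 1 (code_nth (bfst p.1) n) p].

Let Q_equivalence : equivalence_on DQ Q.
Proof.
split.
- by move=> [x y] /= [lx [exy [_ [Sx Sy]]]]; do !split=> //=; rewrite -exy.
- by move=> x [lx Sx]; do !split.
- move=> x y /= [lx [exy [Exy [Sx Sy]]]]; rewrite exy in lx.
  by do !split=> //; exact: E_sym.
- move=> x y z /= [lx [exy [Exy [Sx Sy]]]] [_ [eyz [Eyz [_ Sz]]]].
  by do !split=> //=; [rewrite exy|exact: E_trans Exy Eyz].
Qed.

Let Q_not_bad p : (forall i j, Q (p i, p j)) ->
  ~ bad_for (bfst (p 0%N)) (pack (fun i => bsnd (p i))).
Proof.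
move=> hQ bad; have [l0 _] := hQ 0%N 0%N.
have [|a ba] := bad_for_bad_set (v := v) bad; last exact: lose_bad_set l0 _ ba.
move=> i; rewrite /member packK; have [_ [/= -> [_ [_ Si]]]] := hQ 0%N i.
by rewrite bpairK.
Qed.

Let memberE p i : (forall i j, Q (p i, p j)) ->
  member (bfst (p 0%N)) (pack (fun i => bsnd (p i))) i = p i.
Proof.
by move=> hQ; rewrite /member packK; have [_ [/= -> _]] := hQ 0%N i; rewrite bpairK.
Qed.

(** Otherwise the constant family [x] would be bad for [bfst x]. *)
Let Q_code x n : DQ x -> is_code U (code_nth (bfst x) n).
Proof.
move=> Dx; pose p (i : nat) := x; have hQ i j : Q (p i, p j).
  by case: Q_equivalence => _ r _ _; exact: r.
apply: contrapT => nc; apply: (Q_not_bad hQ); split; last by left; exists n.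
by move=> i j; rewrite !memberE.
Qed.

Let Q_good :
  [/\ forall n, equivalence_on DQ (F n `&` Q),
      forall n x, finite_set [set y | (F n `&` Q) (x, y)],
      forall n, F n `&` Q `<=` F n.+1 `&` Q & Q `<=` \bigcup_n (F n `&` Q)].
Proof.
have codes p : (forall i j, Q (p i, p j)) -> exists G : nat -> set (baire * baire),
    (forall n, borel_code U (code_nth (bfst (p 0%N)) n) (G n)) /\
    forall n i j, F n (p i, p j) <-> G n (p i, p j).
  move=> hQ; have D0 : DQ (p 0%N).
    by case: Q_equivalence => h _ _ _; case: (h _ (hQ 0%N 0%N)).
  have /choice[G hG] n := Q_code n D0; exists G; split=> // n i j.
  have [_ [/= e0 _]] := hQ 0%N i.
  by rewrite /F /= -e0; exact: evaluates1P.
have [|h1 h2 h3] := good_family Q_equivalence (F := F).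
  move=> p hQ bad; have [G [cG FG]] := codes p hQ.
  apply: (Q_not_bad hQ); apply/(bad_forP _ cG); split.
    by move=> i j; rewrite !memberE //; case: (hQ i j) => _ [_ []].
  left; have -> : member (bfst (p 0%N)) (pack (fun i => bsnd (p i))) = p.
    by apply/funext => i; exact: memberE.
  move: bad; rewrite /bad_family (@bad_pattern_equiv _ (fun n i j => G n (p i, p j)) _
    (fun n i j => ~ G n (p i, p j))) // => n i j.
  by split=> h /FG.
split=> // -[x y] Qxy.
pose p i := if i is 0%N then x else y.
have hQ i j : Q (p i, p j).
  have [h r s t] := Q_equivalence; have [Dx Dy] := h _ Qxy.
  by case: i => [|i]; case: j => [|j] //=; [exact: r|exact: s|exact: r].
have [G [cG FG]] := codes p hQ.
apply: contrapT => nF; apply: (Q_not_bad hQ); apply/(bad_forP _ cG); split.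
  by move=> i j; rewrite !memberE //; case: (hQ i j) => _ [_ []].
right; exists 0%N, 1%N => n; rewrite !memberE // => /FG Fn.
by apply: nF; exists n.
Qed.

Let Q_borel (T : topologicalType) (x y : T -> baire) :
  continuous x -> continuous y -> borel [set t | Q (x t, y t)].
Proof.
move=> cx cy; apply: borel_and.
  exact: (borel_preimage (continuous_comp2 cx bfst_continuous) lo_borel).
apply: borel_and.
  by apply: eq_borel; apply: continuous_comp2 bfst_continuous.
apply: borel_and; first exact: E_borel.
by apply: borel_and; apply: S_borel => //; exact: cst_continuous.
Qed.

(** As [e] varies, [F n] is given only by evaluation. On the Borel set [Q] all [e] consist of codes,
    so the two evaluations split [Q] into disjoint analytic sets, which Lusin separation makes
    Borel. *)
Let FQ_borel n : borel (F n `&` Q).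
Proof.
pose A b := [set x | Q (unpair x) /\
  evaluates U b (code_nth (bfst (bfst x)) n) (unpair x)].
have sA b : Sigma11 (A b).
  apply: Sigma11_and.
    apply: borel_Sigma11; apply: Q_borel; first exact: bfst_continuous.
    exact: bsnd_continuous.
  apply: (@evaluates_Sigma11 _ U baire unpair b _ id) => //; last exact: id_continuous.
  apply: continuous_comp2 (@code_nth_continuous n).
  exact: continuous_comp2 bfst_continuous bfst_continuous.
have code p : Q p -> is_code U (code_nth (bfst p.1) n).
  by case: Q_equivalence => h _ _ _ /h[Dp _]; exact: Q_code.
have [x [Qx h1] [_ h0]|B [bB h1 h0]] := lusin_separation (sA 1%N) (sA 0%N).
  have [G hG] := code _ Qx.
  by apply: (proj1 (evaluates0P _ hG)) h0 _; apply/(evaluates1P _ hG).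
have -> : F n `&` Q = [set p | Q (p.1, p.2) /\ B (bpair p.1 p.2)].
  apply/seteqP; split=> [[x y] [Fxy Qxy]|[x y] /= [Qxy Bxy]]; split=> //=.
    by apply: h1; rewrite /A /= /unpair bfstK bsndK.
  have [G /= hG] := code _ Qxy; apply/(evaluates1P _ hG); apply: contrapT => nG.
  apply: h0 Bxy; rewrite /A /= /unpair bfstK bsndK; split=> //.
  exact/(evaluates0P _ hG).
apply: borel_and.
  by apply: Q_borel; [exact: fst_continuous|exact: snd_continuous].
have cb : continuous (fun p : baire * baire => bpair p.1 p.2).
  by apply: bpair_continuous; [exact: fst_continuous|exact: snd_continuous].
exact: (borel_preimage cb bB).
Qed.

Let bound e := winning_map C M fam nb v z0 e.

Let bound_dominates x : ~ lo (bfst x) -> S v x ->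
  D (of_gaps (bound (bfst x)), set_of x).
Proof.
move=> nl Sx; apply: contrapT => /le_inftyPn[N hN]; apply: Sx.
(* The modification copies [bound] up to [N]; from [N] on, [bound] is at most its [gap_sum], which
   is below the enumeration of [set_of x]. *)
exists (pickle (mkseq (bound (bfst x)) N)), (bound (bfst x)); split; last first.
  exact: winning_map_set.
move=> n; rewrite /modify pickleK /= size_mkseq; case: ltnP => [nN|Nn].
  by rewrite nth_mkseq.
apply: leq_trans (gap_sum_ge _ _) _; apply: ltnW; exact: (hN n).
Qed.

Variable FD : nat -> set ((infsets * infsets) * (infsets * infsets)).
Hypothesis FD_equivalence : forall n, borel_equivalence_on D (FD n).
Hypothesis FD_finite : forall n x, finite_set [set y | FD n (x, y)].
Hypothesis FD_mono : forall n, FD n `<=` FD n.+1.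
Hypothesis FD_union : er_restrict (eq_times E) D = \bigcup_n FD n.

Let DW : set baire := [set x | ~ lo (bfst x) /\ S v x].
Let bounded x := (of_gaps (bound (bfst x)), set_of x).
(** The pullback of [FD n] along [bounded]; the equality of codes is required separately since
    distinct [e] may share the same [bound]. *)
Let W n : set (baire * baire) := [set p | (DW p.1 /\ DW p.2) /\
  (bfst p.1 = bfst p.2 /\ FD n (bounded p.1, bounded p.2))].

Let W_equivalence n : equivalence_on DW (W n).
Proof.
have [[_ r s t] _] := FD_equivalence n; split.
- by move=> [x y] [].
- move=> x Dx; do !split=> //; apply: r.
  by case: Dx => nl Sx; exact: bound_dominates.
- by move=> x y [[Dx Dy] [exy Fxy]]; do !split=> //=; exact: s.
- move=> x y z [[Dx Dy] [exy Fxy]] [[_ Dz] [eyz Fyz]]; do !split=> //=.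
    by rewrite exy.
  exact: t Fxy Fyz.
Qed.

Let W_finite n x : finite_set [set y | W n (x, y)].
Proof.
pose r (w : infsets * infsets) := bpair (bfst x) (gaps w.2).
apply: (@sub_finite_set _ _ (r @` [set w | FD n (bounded x, w)])).
  move=> y [_ [/= exy Fxy]]; exists (bounded y) => //.
  by rewrite /r /bounded /= of_gapsK exy bpairK.
exact/finite_image/FD_finite.
Qed.

Let W_borel n : borel (W n).
Proof.
have bDW (T : topologicalType) (x : T -> baire) : continuous x ->
    borel [set t | DW (x t)].
  move=> cx; apply: borel_and.
    apply: borel_not.
    exact: (borel_preimage (continuous_comp2 cx bfst_continuous) lo_borel).
  by apply: S_borel => //; exact: cst_continuous.
have c1 := @fst_continuous baire baire; have c2 := @snd_continuous baire baire.
apply: borel_and; first by apply: borel_and; exact: bDW.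
apply: borel_and.
  by apply: eq_borel; apply: continuous_comp2 bfst_continuous.
pose quad b := ((of_gaps (bfst (bfst b)), of_gaps (bsnd (bfst b))),
                (of_gaps (bfst (bsnd b)), of_gaps (bsnd (bsnd b)))).
have cquad : continuous quad.
  apply: continuous_pair; apply: continuous_pair;
    apply: continuous_comp2 of_gaps_continuous.
  - exact: continuous_comp2 bfst_continuous bfst_continuous.
  - exact: continuous_comp2 bfst_continuous bsnd_continuous.
  - exact: continuous_comp2 bsnd_continuous bfst_continuous.
  - exact: continuous_comp2 bsnd_continuous bsnd_continuous.
(* [bound] is known to be Borel, not continuous; so [FD n] is pulled back to the Baire space by
   [quad] and then along [theta], which is Borel coordinate by coordinate. *)
pose theta (p : baire * baire) := bpair (bpair (bound (bfst p.1)) (bsnd p.1))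
                                        (bpair (bound (bfst p.2)) (bsnd p.2)).
have -> : (fun p => FD n (bounded p.1, bounded p.2)) = theta @^-1` (quad @^-1` FD n).
  by apply/seteqP; split=> p; rewrite /= /quad /theta !(bfstK, bsndK).
have bFD : borel (FD n) by case: (FD_equivalence n).
apply: borel_preimage_baire (borel_preimage cquad bFD) => i m.
have coord (f g : baire * baire -> baire) :
    (forall i m, borel [set p | f p i = m]) ->
    (forall i m, borel [set p | g p i = m]) ->
    forall i m, borel [set p | bpair (f p) (g p) i = m].
  by move=> hf hg k l; rewrite /bpair; case: (odd k).
have lc (f : baire * baire -> baire) : continuous f ->
    forall i m, borel [set p | f p i = m].
  move=> /continuous_baireP cf k l; apply: lconst_borel.
  exact: (lconst_comp (eq^~ l)).
have bd (f : baire * baire -> baire) : continuous f ->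
    forall i m, borel [set p | bound (bfst (f p)) i = m].
  move=> cf k l; have cf' := continuous_comp2 cf bfst_continuous.
  exact: (borel_preimage cf' (winning_map_borel M fam nb cC z0P k l)).
move: i m; apply: (coord) => i m; apply: (coord) => k l.
- exact: bd.
- by apply: (lc (fun p => bsnd p.1)); exact: continuous_comp2 c1 bsnd_continuous.
- exact: bd.
- by apply: (lc (fun p => bsnd p.2)); exact: continuous_comp2 c2 bsnd_continuous.
Qed.

Lemma coded_relation_hyperfinite : hyperfinite_on setT (coded_relation v).
Proof.
have [eF fF iF uF] := Q_good.
(* The diagonal, the part off [lo] governed by the hypothesis on [D], and the part over [lo] where
   [e] itself provides the witness. *)
have -> : coded_relation v =
    \bigcup_n [set p | p.1 = p.2 \/ (W n p \/ (F n `&` Q) p)].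
  apply/seteqP; split=> [[x y]|[x y] [n _]].
    case=> /= [->|[exy [Exy [Sx Sy]]]]; first by exists 0%N => //; left.
    have [lx|nlx] := pselect (lo (bfst x)).
      have [|n _ Fxy] := uF (x, y); first by do !split.
      by exists n => //; right; right.
    have nly : ~ lo (bfst y) by rewrite -exy.
    have : er_restrict (eq_times E) D (bounded x, bounded y).
      split; first by rewrite /eq_times /= exy.
      by split; exact: bound_dominates.
    by rewrite FD_union => -[n _ Fxy]; exists n => //; right; left.
  case=> /= [->|[[[[_ Sx] [_ Sy]] [exy Fxy]]|[_ [_ [exy [Exy [Sx Sy]]]]]]].
  - by left.
  - right; do !split=> //.
    have : er_restrict (eq_times E) D (bounded x, bounded y).
      by rewrite FD_union; exists n.
    by case=> -[].
  - by right.
apply: hyperfinite_bigcup.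
- move=> n; split.
    by apply: equivalence_glue (W_equivalence n) (eF n) _ => x [nl _] [].
  apply: borel_or.
    by apply: eq_borel; [exact: fst_continuous|exact: snd_continuous].
  by apply: borel_or; [exact: W_borel|exact: FQ_borel].
- move=> n x.
  apply: (@sub_finite_set _ _ ([set x] `|` ([set y | W n (x, y)] `|`
    [set y | (F n `&` Q) (x, y)]))); last first.
    rewrite !finite_setU; split; first exact: finite_set1.
    by split; [exact: W_finite|exact: fF].
  by move=> y [/= ->|[?|?]]; [left|right; left|right; right].
- move=> n p [?|[[? [? ?]]|/iF]]; [by left|right; left|by right; right].
  by do !split=> //; exact: FD_mono.
Qed.

End hyperfinite_case.
End lower_bound.

Theorem theorem2p1 (R : realType) :
  let D : set (infsets * infsets) := [set p | le_infty p.2 p.1] in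
  (exists E : set (infsets * infsets),
     [/\ cber_on setT E,
         ~ hyperfinite_on setT E &
         hyperfinite_on D (er_restrict (eq_times E) D)]) ->
  (forall X : topologicalType, polish R X ->
   forall U : nat -> set (X * X), basis (range U) ->
   Sigma12 (hyperfinite_codes U)) /\
  (exists2 X : topologicalType, polish R X &
   forall U : nat -> set (X * X), basis (range U) ->
   Sigma12_hard R (hyperfinite_codes U)).
Proof.
move=> D [E [cE nhE [_ [FD [eFD fFD iFD uFD]]]]]; split.
  by move=> X pX U; exact: hyperfinite_codes_Sigma12 pX.
exists baire; first exact: polish_baire.
move=> U bU V pV zV B sB.
have [neV|eV] := pselect (exists _ : V, True); last first.
  (* On an empty [V] any constant map is a reduction. *)
  exists (fun=> (fun=> 0%N) : baire); first exact: cst_continuous.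
  by apply/seteqP; split=> x _; case: eV; exists x.
have [i ci [C cC BC]] := Sigma12_baire pV zV sB neV.
have [ev cev evP] := bad_for_Sigma11 cE bU.
have evP' e c : bad_for E U e c <-> exists w, ev ((e, c), w).
  by have -> : bad_for E U e c = [set p | bad_for E U p.1 p.2] (e, c) by []; rewrite evP.
have [f cf hf] := section_codes bU (coded_relation_borel cE C ev).
exists (fun v => f (i v)); first exact: continuous_comp2 ci cf.
apply/seteqP; split=> v.
  move=> /BC[z hz]; exists (coded_relation E C ev (i v)); first exact: hf.
  exact: (coded_relation_hyperfinite cE bU cC evP' hz eFD fFD iFD uFD).
move=> [G /(borel_code_inj (hf (i v))) <- hyp]; apply/BC.
apply: contrapT => /forallNP h.
apply: (coded_relation_not_hyperfinite cE bU cev evP' nhE _ hyp) => z.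
by have /existsNP[w /contrapT Cw] := h z; exists w.
Qed.
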